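(* Let $t\ge 2$ and $r_1,\dots,r_t\ge 1$ be integers, let $d=\sum_{i=1}^t r_i+1$, and let $R$ be the Segre product $\#_{i=1}^t \Bbbk[x_{i,1},\dots,x_{i,r_i+1}]$ of polynomial rings over an algebraically closed field $\Bbbk$ of characteristic $p>0$, so that $\dim R=d$. Let $\mathbf{c}=(c_1,\dots,c_{t-1})\in\mathbb{Z}^{t-1}$ satisfy $-r_t\le c_i\le r_i$ for $1\le i\le t-1$ and $-r_j\le c_i-c_j\le r_i$ for $1\le i<j\le t-1$, and let $M_{\mathbf{c}}$ be the corresponding conic divisorial ideal of $R$. Then the generalized $F$-signature $s(M_{\mathbf{c}})=s(M_{\mathbf{c}},R)$ is $$s(M_{\mathbf{c}})=\frac{1}{d!}\sum_{\alpha_1=0}^{r_1}\cdots\sum_{\alpha_{t-1}=0}^{r_{t-1}}|U(\alpha_1,\dots,\alpha_{t-1})|,$$ where $U(\alpha_1,\dots,\alpha_{t-1})$ is the set of permutations $w=w_1\cdots w_d\in\mathfrak{S}_d$ satisfying the following two conditions: (i) $\mathrm{des}\bigl(w_1\cdots w_{\sum_{q=i+1}^t r_q+1}\bigr)=r_t-r_i+c_i+\sum_{\ell=i}^{t-1}\alpha_\ell$ for each $i=1,\dots,t-1$; (ii) for each $i=2,\dots,t$, $\mathrm{des}\bigl(w_{\sum_{q=i}^t r_q}\cdots w_d\bigr)\in\bigl\{\sum_{\ell=1}^{i-1}\alpha_\ell,\ \sum_{\ell=1}^{i-1}\alpha_\ell+1\bigr\}$, and if it equals $\sum_{\ell=1}^{i-1}\alpha_\ell$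 then $w_{\sum_{q=i}^t r_q}<w_d$ holds, while if it equals $\sum_{\ell=1}^{i-1}\alpha_\ell+1$ then $w_{\sum_{q=i}^t r_q}>w_d$ holds.
   Context: Permutations and descents: $\mathfrak{S}_d$ is the set of permutations of $\{1,\dots,d\}$, written in one-line notation $w=w_1w_2\cdots w_d$ (meaning $i\mapsto w_i$). For $1\le i\le j\le d$, $\mathrm{des}(w_iw_{i+1}\cdots w_j)$ is the number of indices $\ell\in\{i,\dots,j-1\}$ with $w_\ell>w_{\ell+1}$. The ring as a toric (Hibi) ring: the Segre product $\#_{i=1}^t \Bbbk[x_{i,1},\dots,x_{i,r_i+1}]$ is the $\Bbbk$-algebra generated by all monomials $x_{1,j_1}x_{2,j_2}\cdots x_{t,j_t}$ with $1\le j_i\le r_i+1$. It is identified with the following toric ring. Take $\mathbb{R}^d$ with coordinates $x_0$ and $x_{i,j}$ ($1\le i\le t$, $1\le j\le r_i$), and linear forms $\sigma_{i,0}=x_0-x_{i,1}$, $\sigma_{i,j}=x_{i,j}-x_{i,j+1}$ for $1\le j\le r_i-1$, and $\sigma_{i,r_i}=x_{i,r_i}$ ($1\le i\le t$). Then $R=\Bbbk[\{\mathbf{m}\in\mathbb{Z}^d : \sigma_{i,j}(\mathbf{m})\ge 0 \text{ for all } 1\le i\le t,\ 0\le j\le r_i\}]$. (This is the Hibi ring of the poset that is the disjoint union of $t$ chains of lengths $r_1,\dots,r_t$ elements.) Divisorial ideals: for a family of integers $\mathbf{a}=(a_{i,j})$, $T(\mathbf{a})$ is the $R$-module generated by all Laurent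 monomials with exponent vector $\mathbf{m}\in\mathbb{Z}^d$ such that $\sigma_{i,j}(\mathbf{m})\ge a_{i,j}$ for all $i,j$. It is a divisorial ideal, and it is called conic if (up to isomorphism) $a_{i,j}=\lceil\sigma_{i,j}(\mathbf{x})\rceil$ for all $i,j$, for some $\mathbf{x}\in\mathbb{R}^d$. One has $\mathrm{Cl}(R)\cong\mathbb{Z}^{t-1}$, where $\mathbf{c}=(c_1,\dots,c_{t-1})$ corresponds to the divisorial ideal $M_{\mathbf{c}}=T(\mathbf{a})$ with $a_{i,0}=c_i$ for $1\le i\le t-1$ and all other $a_{i,j}=0$. The ideal $M_{\mathbf{c}}$ is conic exactly when $\mathbf{c}$ satisfies the inequalities in the claim, and distinct such $\mathbf{c}$ give non-isomorphic modules. Generalized $F$-signature: for every $e\in\mathbb{N}$ the $R$-module $R^{1/p^e}$ is a finite direct sum of conic divisorial ideals, of which there are finitely many up to isomorphism; passing to the completion at the irrelevant maximal ideal, where the Krull-Schmidt property holds, the multiplicities are well defined. If $c_e(M)$ denotes the multiplicity of the conic divisorial ideal $M$ in $R^{1/p^e}$, the generalized $F$-signature of $M$ is $s(M,R)=\lim_{e\to\infty}c_e(M)/p^{ed}$ with $d=\dim R$. *)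

(* Defs.v *)
From HB Require Import structures.
From mathcomp Require Import all_boot all_order all_fingroup all_algebra finmap.
From mathcomp Require Import zify.
From mathcomp Require Import boolp classical_sets functions reals topology.
From mathcomp Require Import normedtype sequences.

Set Implicit Arguments.
Unset Strict Implicit.
Unset Printing Implicit Defensive.

Import Order.TTheory GRing.Theory Num.Theory.
Import numFieldNormedType.Exports.

Local Open Scope ring_scope.

(* The group algebra K[G] of an additive group G: finitely supported functions
   G -> K with the convolution product.  (The monoid algebras of monalg require
   a monoid without nontrivial units, which excludes Z^d and Q^d.) *)
Record gralg (K : comNzRingType) (G : zmodType) : predArgType :=
  Gralg { gralg_val : {fsfun G -> K with 0} }.

HB.instance Definition _ (K : comNzRingType) (G : zmodType) :=
  [isNew for @gralg_val K G].
HB.instance Definition _ (K : comNzRingType) (G : zmodType) :=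
  [Choice of gralg K G by <:].

Section GroupAlgebra.
Variables (K : comNzRingType) (G : zmodType).
Local Notation A := (gralg K G).
Implicit Types (f g h : A) (m : G) (c : K).

Definition gcoef f m : K := gralg_val f m.
Definition gsupp f : {fset G} := finsupp (gralg_val f).

Lemma gralgP f g : (forall m, gcoef f m = gcoef g m) <-> f = g.
Proof.
split=> [fg|-> //]; apply: val_inj => /=.
by apply/fsfunP => m; apply: fg.
Qed.

Lemma gcoef_out f m : m \notin gsupp f -> gcoef f m = 0.
Proof. by rewrite /gsupp /gcoef; apply: fsfun_dflt. Qed.

Definition gzero : A := Gralg [fsfun].
Definition gopp f : A := Gralg [fsfun m in gsupp f => - gcoef f m].
Definition gadd f g : A :=
  Gralg [fsfun m in (gsupp f `|` gsupp g)%fset => gcoef f m + gcoef g m].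

(* [gmono m c] is the monomial c x^m *)
Definition gmono m c : A := Gralg [fsfun k in [fset m]%fset => c].

Lemma gzeroE m : gcoef gzero m = 0.
Proof. by rewrite /gcoef fsfun_dflt // finsupp0. Qed.

Lemma goppE f m : gcoef (gopp f) m = - gcoef f m.
Proof.
rewrite {1}/gcoef fsfunE; case: ifP => // /negbT /gcoef_out ->.
by rewrite oppr0.
Qed.

Lemma gaddE f g m : gcoef (gadd f g) m = gcoef f m + gcoef g m.
Proof.
rewrite {1}/gcoef fsfunE in_fsetU; case: ifP => // /negbT.
by rewrite negb_or => /andP[/gcoef_out -> /gcoef_out ->]; rewrite addr0.
Qed.

Lemma gmonoE m c k : gcoef (gmono m c) k = c *+ (k == m).
Proof.
by rewrite {1}/gcoef fsfunE in_fset1; case: eqP; rewrite ?mulr1n ?mulr0n.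
Qed.

Lemma gaddA : associative gadd.
Proof. by move=> f g h; apply/gralgP => m; rewrite !gaddE addrA. Qed.
Lemma gaddC : commutative gadd.
Proof. by move=> f g; apply/gralgP => m; rewrite !gaddE addrC. Qed.
Lemma gadd0 : left_id gzero gadd.
Proof. by move=> f; apply/gralgP => m; rewrite gaddE gzeroE add0r. Qed.
Lemma gaddN : left_inverse gzero gopp gadd.
Proof. by move=> f; apply/gralgP => m; rewrite gaddE gzeroE goppE addNr. Qed.

HB.instance Definition _ := GRing.isZmodule.Build A gaddA gaddC gadd0 gaddN.

Lemma gcoefD f g m : gcoef (f + g) m = gcoef f m + gcoef g m.
Proof. exact: gaddE. Qed.
Lemma gcoef0 m : gcoef 0 m = 0.
Proof. exact: gzeroE. Qed.
Lemma gcoef_sum I (s : seq I) (P : pred I) (F : I -> A) m :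
  gcoef (\sum_(i <- s | P i) F i) m = \sum_(i <- s | P i) gcoef (F i) m.
Proof.
by apply: (big_morph (gcoef^~ m)) => [f g|]; [exact: gcoefD|exact: gcoef0].
Qed.

Lemma gmonoD m c c' : gmono m (c + c') = gmono m c + gmono m c'.
Proof. by apply/gralgP => k; rewrite gcoefD !gmonoE mulrnDl. Qed.
Lemma gmono0 m : gmono m 0 = 0.
Proof. by apply/gralgP => k; rewrite gmonoE mul0rn gcoef0. Qed.

Lemma gralgE_wide (d : {fset G}) f : (gsupp f `<=` d)%fset ->
  f = \sum_(m <- d) gmono m (gcoef f m).
Proof.
move=> fd; apply/gralgP => k; rewrite gcoef_sum.
under eq_bigr do rewrite gmonoE.
have [kd|kd] := boolP (k \in d).
  rewrite (big_fsetD1 k) //= eqxx mulr1n big1_fset ?addr0 //.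
  move=> m; rewrite in_fsetD1 => /andP[/negbTE mk _] _.
  by rewrite eq_sym mk.
rewrite gcoef_out; last by apply: contra kd; apply/fsubsetP.
rewrite big1_fset // => m md _; case: eqP => [km|]; rewrite ?mulr0n //.
by rewrite km md in kd.
Qed.

Definition gmul f g : A :=
  \sum_(m <- gsupp f) \sum_(k <- gsupp g) gmono (m + k) (gcoef f m * gcoef g k).

Lemma gmul_wide (d1 d2 : {fset G}) f g :
  (gsupp f `<=` d1)%fset -> (gsupp g `<=` d2)%fset ->
  gmul f g =
  \sum_(m <- d1) \sum_(k <- d2) gmono (m + k) (gcoef f m * gcoef g k).
Proof.
move=> f1 g2; rewrite /gmul (big_fset_incl _ f1) /=; last first.
  by move=> m _ /gcoef_out ->; rewrite big1 // => k _; rewrite mul0r gmono0.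
apply: eq_bigr => m _; apply: big_fset_incl => // k _ /gcoef_out ->.
by rewrite mulr0 gmono0.
Qed.

Lemma gsupp_mono m c : (gsupp (gmono m c) `<=` [fset m])%fset.
Proof.
apply/fsubsetP => k; rewrite in_fset1; apply: contraTT => km.
by rewrite /gsupp mem_finsupp -/(gcoef _ _) gmonoE (negbTE km) mulr0n eqxx.
Qed.

Lemma gmul_mono m k c c' :
  gmul (gmono m c) (gmono k c') = gmono (m + k) (c * c').
Proof.
rewrite (gmul_wide (gsupp_mono m c) (gsupp_mono k c')) !big_seq_fset1.
by rewrite !gmonoE !eqxx !mulr1n.
Qed.

Lemma gmulC : commutative gmul.
Proof.
move=> f g; rewrite /gmul exchange_big /=; apply: eq_bigr => m _.
by apply: eq_bigr => k _; rewrite addrC mulrC.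
Qed.

Lemma gsuppD f g : (gsupp (f + g)%R `<=` gsupp f `|` gsupp g)%fset.
Proof.
apply/fsubsetP => k; apply: contraTT; rewrite in_fsetU negb_or => /andP[kf kg].
by rewrite /gsupp mem_finsupp -/(gcoef _ _) gcoefD !gcoef_out // addr0 eqxx.
Qed.

Lemma gmulDl : left_distributive gmul +%R.
Proof.
move=> f g h.
rewrite (gmul_wide (gsuppD f g) (fsubset_refl (gsupp h))).
rewrite (gmul_wide (fsubsetUl (gsupp f) (gsupp g)) (fsubset_refl (gsupp h))).
rewrite (gmul_wide (fsubsetUr (gsupp f) (gsupp g)) (fsubset_refl (gsupp h))).
rewrite -big_split /=; apply: eq_bigr => m _.
rewrite -big_split /=; apply: eq_bigr => k _.
by rewrite gcoefD mulrDl gmonoD.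
Qed.

Lemma gmulDr : right_distributive gmul +%R.
Proof. by move=> f g h; rewrite !(gmulC f) gmulDl. Qed.

Lemma gmul0l g : gmul 0 g = 0.
Proof. by apply: (@addIr _ (gmul 0 g)); rewrite -gmulDl !add0r. Qed.

Lemma gmul_suml I (s : seq I) (F : I -> A) g :
  gmul (\sum_(i <- s) F i) g = \sum_(i <- s) gmul (F i) g.
Proof.
apply: (big_morph (gmul^~ g)) => [f h|]; [exact: gmulDl|exact: gmul0l].
Qed.

Lemma gmul_sumr I (s : seq I) (F : I -> A) g :
  gmul g (\sum_(i <- s) F i) = \sum_(i <- s) gmul g (F i).
Proof. by rewrite gmulC gmul_suml; apply: eq_bigr => i _; rewrite gmulC. Qed.

Lemma gmulA : associative gmul.
Proof.
move=> f g h.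
rewrite (gralgE_wide (fsubset_refl (gsupp f))) !gmul_suml.
apply: eq_bigr => m _.
rewrite (gralgE_wide (fsubset_refl (gsupp g))) gmul_suml !gmul_sumr gmul_suml.
apply: eq_bigr => k _.
rewrite (gralgE_wide (fsubset_refl (gsupp h))) !gmul_sumr.
by apply: eq_bigr => l _; rewrite !gmul_mono addrA mulrA.
Qed.

Definition gone : A := gmono 0 1.

Lemma gmul1 : left_id gone gmul.
Proof.
move=> f; rewrite {2}(gralgE_wide (fsubset_refl (gsupp f))).
rewrite (gmul_wide (gsupp_mono 0 1) (fsubset_refl _)) big_seq_fset1.
by apply: eq_bigr => m _; rewrite gmonoE eqxx mulr1n mul1r add0r.
Qed.

Lemma gone_neq0 : gone != 0.
Proof.
apply/eqP => /gralgP /(_ 0) /eqP.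
by rewrite gcoef0 gmonoE eqxx mulr1n oner_eq0.
Qed.

HB.instance Definition _ := GRing.Zmodule_isComNzRing.Build A
  gmulA gmulC gmul1 gmulDl gone_neq0.

Lemma gmonoM m k c c' : gmono m c * gmono k c' = gmono (m + k) (c * c').
Proof. exact: gmul_mono. Qed.

End GroupAlgebra.

Local Open Scope classical_set_scope.

Section Submodules.
Variable A : comNzRingType.

(* S-linear isomorphism between S-submodules P of V and Q of W, for a subring S
   of A; only the values of the map on P matter. *)
Definition sub_iso (S : set A) (V W : lmodType A) (P : set V) (Q : set W) :=
  exists phi : V -> W,
    [/\ set_bij P Q phi,
        forall x y, P x -> P y -> phi (x + y) = phi x + phi y &
        forall s x, S s -> P x -> phi (s *: x) = s *: phi x].

Definition ideal_iso (S P Q : set A) := @sub_iso S A^o A^o P Q.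

Definition gen_submod (S X : set A) : set A :=
  [set f | exists (N : nat) (s x : 'I_N -> A),
     (forall i, S (s i) /\ X (x i)) /\ f = \sum_(i < N) s i * x i].

Definition direct_sum (N : nat) (D : 'I_N -> set A) : set {ffun 'I_N -> A^o} :=
  [set v | forall i, D i (v i)].

(* S^{1/q}; it contains all q-th roots of elements of S as soon as A does *)
Definition root_ring (S : set A) (q : nat) : set A := [set f | S (f ^+ q)].

End Submodules.

Section Toric.
Variables (n : nat) (r : 'I_n.+1 -> nat).

(* the coordinates x_0 and x_{i,j}; both i and j are shifted to start at 0 *)
Definition coord : finType := option {i : 'I_n.+1 & 'I_(r i)}.

(* the sequence x_0, x_{i,1}, ..., x_{i,r_i}, 0, 0, ... *)
Definition chain (V : zmodType) (x : coord -> V) (i : 'I_n.+1) (j : nat) : V :=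
  if j is j'.+1
  then oapp (fun k : 'I_(r i) => x (Some (Tagged (fun i => 'I_(r i)) k))) 0
            (insub j')
  else x None.

Definition sigma (V : zmodType) (x : coord -> V) (i : 'I_n.+1)
  (j : 'I_(r i).+1) : V := chain x i j - chain x i j.+1.

(* Exponents are rational, so that R^{1/p^e} lives in the same ambient ring: as
   K is perfect, every element of R has its p^e-th root in K[Q^d]. *)
Definition expo := {ffun coord -> rat}.

Definition int_family := forall i : 'I_n.+1, 'I_(r i).+1 -> int.

Definition lattice_points (a : int_family) : set expo :=
  [set m | (forall k, m k \is a Num.int) /\
           (forall i j, (a i j)%:~R <= sigma m (i := i) j)].

Lemma chain_sum (V : zmodType) (x : coord -> V) i j : (j <= (r i).+1)%N ->
  chain x i j = \sum_(k < (r i).+1 | (j <= k)%N) sigma x k.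
Proof.
move=> jr.
have -> : \sum_(k < (r i).+1 | (j <= k)%N) sigma x k =
          \sum_(j <= k < (r i).+1) (chain x i k - chain x i k.+1).
  rewrite (big_nat_widenl _ 0%N) //= big_mkord.
  by apply: eq_big => // k; rewrite andbT.
rewrite -[RHS]opprK -sumrN.
under eq_bigr do rewrite opprB.
rewrite telescope_sumr // opprB.
by rewrite [X in _ - X]/= insubF ?subr0 // ltnn.
Qed.

Lemma sigma_inj (V : zmodType) (x y : coord -> V) :
  (forall i j, sigma x (i := i) j = sigma y (i := i) j) -> x =1 y.
Proof.
move=> xy; have cxy i j : (j <= (r i).+1)%N -> chain x i j = chain y i j.
  by move=> jr; rewrite !chain_sum //; apply: eq_bigr => k _.
case=> [[i k]|]; last exact: (cxy ord0 0%N).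
by have := cxy i k.+1 (ltnW (ltn_ord k : k.+1 < (r i).+1)%N); rewrite /= (valK k).
Qed.

(* In the coordinates sigma_{i,j}, the exponents of R are the finite sums of
   vectors selecting one index J i in every row i, i.e. the exponents of the
   products of the monomials x_{1,j_1} ... x_{t,j_t}: R is the Segre product. *)
Lemma segre_exponents (u : forall i, 'I_(r i).+1 -> rat) :
  (exists2 m, lattice_points (fun _ _ => 0) m &
     forall i j, sigma m (i := i) j = u i j) <->
  (exists s : seq {dffun forall i, 'I_(r i).+1},
     forall i j, u i j = (count (fun J : {dffun _} => J i == j) s)%:R).
Proof.
split=> [[m [mint mpos] mu]|[s us]].
  have chain_int i j : chain m i j \is a Num.int.
    by case: j => [|j] /=; [exact: mint|case: insub => [k|] //=; exact: rpred0].
  have un i j : {v : nat | u i j = v%:R}.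
    apply/cid/natrP; rewrite -mu natrEint; apply/andP; split.
      by apply: rpredB; apply: chain_int.
    by have := mpos i j; rewrite mulr0z.
  pose un' i (j : 'I_(r i).+1) := sval (un i j).
  have unE i j : u i j = (un' i j)%:R by rewrite /un'; case: (un i j).
  pose N := (\sum_j un' ord0 j)%N.
  have mN : m None = N%:R.
    have /= -> := @chain_sum _ m ord0 0%N isT.
    by rewrite natr_sum; apply: eq_bigr => j _; rewrite -unE -mu.
  pose L i := flatten [seq nseq (un' i j) j | j <- enum 'I_(r i).+1].
  have sL i : (size (L i))%:R = m None.
    have /= -> := @chain_sum _ m i 0%N isT.
    rewrite /L size_flatten /shape -map_comp sumnE big_map big_enum /=.
    by rewrite natr_sum; apply: eq_bigr => j _; rewrite size_nseq -unE -mu.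
  have cL i j : count_mem j (L i) = un' i j.
    rewrite /L count_flatten -map_comp sumnE big_map big_enum /=.
    rewrite (bigD1 j) //= count_nseq /= eqxx mul1n big1 ?addn0 // => k kj.
    by rewrite count_nseq /= (negbTE kj).
  have {}sL i : size (L i) = N by apply/eqP; rewrite -(eqr_nat rat) sL mN.
  exists [seq [ffun i => nth ord0 (L i) k] | k <- iota 0 N] => i j.
  rewrite unE -cL count_map; congr _%:R.
  rewrite -[in LHS](mkseq_nth ord0 (L i)) /mkseq count_map sL.
  by apply: eq_count => k /=; rewrite ffunE.
pose mf (k : coord) : rat := oapp (fun v : {i : 'I_n.+1 & 'I_(r i)} =>
  (count (fun J : {dffun forall i, 'I_(r i).+1} =>
            (tagged v < J (tag v))%N) s)%:R) (size s)%:R k.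
pose m : expo := [ffun k => mf k].
have cm i (j : nat) : (j <= (r i).+1)%N -> chain m i j =
    (count (fun J : {dffun forall i, 'I_(r i).+1} => (j <= J i)%N) s)%:R.
  case: j => [_|j jr] /=; first by rewrite ffunE count_predT.
  case: insubP => [k _ <-|] /=; first by rewrite ffunE.
  rewrite -leqNgt => rj; apply/esym/eqP; rewrite pnatr_eq0.
  rewrite -leqn0 leqNgt -has_count; apply/hasPn => J _.
  by rewrite -leqNgt (leq_trans (leq_ord _)).
have sm i j : sigma m (i := i) j = u i j.
  rewrite us /sigma !cm ?ltn_ord //; last exact: ltnW.
  suff -> : count (fun J : {dffun forall i, 'I_(r i).+1} => (j <= J i)%N) s =
    (count (fun J : {dffun forall i, 'I_(r i).+1} => J i == j) s +
     count (fun J : {dffun forall i, 'I_(r i).+1} => (j < J i)%N) s)%N.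
    by rewrite natrD addrK.
  elim: (s) => //= J s' ->.
  by rewrite leq_eqVlt -val_eqE eq_sym /=; case: ltngtP => _ /=; lia.
exists m => //; split=> [k|i j]; last by rewrite sm us ler0n.
by rewrite ffunE; case: k => [v|]; exact: rpred_nat.
Qed.

Variable K : fieldType.

(* K[cone lattice points]: the elements supported on such exponents *)
Definition toric_ring : set (gralg K expo) :=
  [set f | forall m, gcoef f m != 0 -> lattice_points (fun _ _ => 0) m].

Definition divisorial (a : int_family) : set (gralg K expo) :=
  gen_submod toric_ring [set gmono m 1 | m in lattice_points a].

Definition conic (R : realType) (a : int_family) :=
  exists x : coord -> R, ideal_iso toric_ring (divisorial a)
    (divisorial (fun i j => Num.ceil (sigma x (i := i) j))).

(* [c] is the number of summands isomorphic to [M] in some decomposition of the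
   R-module [N] as a finite direct sum of conic divisorial ideals *)
Definition is_multiplicity (R : realType) (N M : set (gralg K expo))
    (c : nat) :=
  exists (l : nat) (a : 'I_l -> int_family),
    [/\ forall k, conic R (a k),
        @sub_iso _ toric_ring (gralg K expo)^o _ N
          (direct_sum (fun k => divisorial (a k))) &
        c = #|[set k | `[< ideal_iso toric_ring (divisorial (a k)) M >]]%SET| ].

Definition ring_dim : nat := (\sum_(i < n.+1) r i).+1.

(* c_e(M).  Krull-Schmidt makes the value unique; the default 0 of [xget] would
   only be used if R^{1/p^e} had no such decomposition. *)
Definition multiplicity (R : realType) (p : nat) (M : set (gralg K expo))
    (e : nat) : nat :=
  xget 0%N (is_multiplicity R (root_ring toric_ring (p ^ e)) M).

Definition is_gen_Fsignature (R : realType) (p : nat) (M : set (gralg K expo))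
    (s : R) :=
  (multiplicity R p M e)%:R / (p%:R ^+ (e * ring_dim)) @[e --> \oo] --> s.

(* a_{i,0} = c_i for i < t and a_{i,j} = 0 otherwise *)
Definition class_family (c : 'I_n -> int) : int_family :=
  fun i j => if j == ord0 then oapp c 0 (insub (val i)) else 0.

Definition class_module (c : 'I_n -> int) : set (gralg K expo) :=
  divisorial (class_family c).

(* one-line notation: [letter w k] is w_k for 1 <= k <= d (values shifted by 1) *)
Definition letter (d : nat) (w : 'S_d.+1) (k : nat) : nat := w (inord k.-1).

Definition des (d : nat) (w : 'S_d.+1) (i j : nat) : nat :=
  \sum_(i <= l < j) (letter w l > letter w l.+1)%N.

Definition inU (c : 'I_n -> int) (alpha : 'I_n -> nat) (w : 'S_ring_dim) :=
  [forall i : 'I_n,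
     (des w 1 (\sum_(q < n.+1 | (i < q)%N) r q).+1)%:Z ==
     (r ord_max)%:Z - (r (widen_ord (leqnSn n) i))%:Z + c i
     + (\sum_(l < n | (i <= l)%N) alpha l)%:Z]
  && [forall i : 'I_n.+1, (0 < i)%N ==>
      let b := (\sum_(q < n.+1 | (i <= q)%N) r q)%N in
      let D := des w b ring_dim in
      let S := (\sum_(l < n | (l < i)%N) alpha l)%N in
      [&& (D == S) || (D == S.+1),
          (D == S) ==> (letter w b < letter w ring_dim)%N &
          (D == S.+1) ==> (letter w b > letter w ring_dim)%N]].

Definition U (c : 'I_n -> int) (alpha : 'I_n -> nat) : {set 'S_ring_dim} :=
  [set w | inU c alpha w]%SET.

End Toric.

Arguments class_module {n} r K c.
Arguments U {n} r c alpha.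
Arguments is_gen_Fsignature {n r K R} p M s.

(* Main.v *)
Require Import Defs.
From mathcomp Require Import all_boot all_order all_fingroup all_algebra.
From mathcomp Require Import finmap zify lra ring.
From mathcomp Require Import boolp classical_sets functions reals topology.
From mathcomp Require Import normedtype sequences.

(** The theorem holds because both sides count the same order types.

    Sort the exponents of [R^{1/q}], [q = p^e], by their classes modulo [Z^d].
    The class of [-x] contributes, after a shift by [x], the monomials with
    integral exponents [m] such that [sigma m >= sigma x], that is a copy of the
    conic ideal [T(a)] with [a = ceil (sigma x)]; so [R^{1/q}] is the direct sum of
    these ideals over the points [x] of [((1/q) Z / Z)^d]
    ([root_ring_decomposition]).  The multiplicity
    of an ideal can be read off any decomposition: every [R]-linear map between
    divisorial ideals is the multiplication by an element of the group algebra
    ([divisorial_hom]), so an isomorphism between two direct sums is an invertible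
    matrix of such elements, and its coefficients at the exponents which
    realize the isomorphisms within one class form an invertible matrix over [K]
    ([direct_sum_iso_class_le]).  The ideals [T(a)] and [T(b)] are isomorphic
    exactly when [b - a = sigma (m)] for some [m] in [Z^d], which means that the
    row sums of [b - a] all agree ([ideal_iso_same_class], [same_classP]).

    Choose the representative of [x] in the cube (0, 1]^d.  There
    [ceil (sigma_{i,j} x)] is [1] or [0] according to whether
    [x_{i,j} > x_{i,j+1}], so the row sum of [a] is one more than the number of
    descents of the word [x_0 x_{i,1} ... x_{i,r_i}].  Hence [c_e(M_c)] is the
    number of grid points for which the descent numbers of rows [i] and [t]
    differ by [c_i], for all [i] ([multiplicity_class_module]).  This condition
    only depends on the relative order of the coordinates, each of the [d`!]
    strict orders is realized by ['C(q, d)] points, and the points with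
    coincidences are negligible.  So [s(M_c)] is the proportion of the
    permutations in [S_d] that satisfy the condition ([cvg_order_type]).

    It remains to count these permutations.  Write the coordinates as one word
    [w]: the rows [t, ..., 1], each read backwards, and finally [x_0].  Let
    [w_b ... w_d] be a final factor starting with the last letter of a row, and
    close it up into a cycle.  The condition defining [U(alpha)] on final factors
    says that its number of cyclic descents is one more than a partial sum of
    [alpha].  Given this, splitting [des w] at the rows shows that the condition
    on initial factors is the one on the descents of the rows ([inUE]).  Since
    consecutive cyclic descent numbers differ by at most [r_i] and do not
    decrease, every [w] with the right row descents belongs to exactly one
    [U(alpha)] ([sum_card_U]). *)

Set Implicit Arguments.
Unset Strict Implicit.
Unset Printing Implicit Defensive.

Import Order.TTheory GRing.Theory Num.Theory.
Import numFieldNormedType.Exports.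

Local Open Scope ring_scope.
Local Open Scope classical_set_scope.

(** * Monomials in the group algebra *)

Section GroupAlgebraMore.
Variables (K : comNzRingType) (G : zmodType).
Implicit Types (f g : gralg K G) (m k : G) (c : K).

Lemma gcoefM f g k :
  gcoef (f * g) k = \sum_(m <- gsupp f) gcoef f m * gcoef g (k - m).
Proof.
rewrite -[f * g]/(gmul f g) /gmul gcoef_sum; apply: eq_bigr => m _.
rewrite gcoef_sum (eq_bigr (fun l => (gcoef f m * gcoef g l) *+ (l == k - m))).
  have [kg|kg] := boolP (k - m \in gsupp g).
    rewrite (big_fsetD1 (k - m)) //= eqxx mulr1n big1_fset ?addr0 // => l.
    by rewrite in_fsetD1 => /andP[/negbTE -> _].
  rewrite (gcoef_out kg) mulr0 big1_fset // => l lg _.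
  by case: eqP => // lk; rewrite -lk lg in kg.
move=> l _; rewrite gmonoE; congr (_ *+ _).
by rewrite eq_sym -[in RHS](inj_eq (addIr m)) subrK addrC.
Qed.

Lemma gcoef_monoM f m c k : gcoef (gmono m c * f) k = c * gcoef f (k - m).
Proof.
have [->|cn0] := eqVneq c 0; first by rewrite gmono0 mul0r gcoef0 mul0r.
have -> : gmono m c * f = \sum_(l <- gsupp f) gmono (m + l) (c * gcoef f l).
  rewrite -[LHS]/(gmul _ _) (gmul_wide (gsupp_mono m c) (fsubset_refl _)).
  by rewrite big_seq_fset1; under eq_bigr do rewrite gmonoE eqxx mulr1n.
rewrite gcoef_sum; under eq_bigr do rewrite gmonoE.
have kE l : (k == m + l) = (l == k - m).
  by rewrite eq_sym -[in RHS](inj_eq (addIr m)) subrK addrC.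
have [kg|kg] := boolP (k - m \in gsupp f).
  rewrite (big_fsetD1 (k - m)) //= kE eqxx mulr1n big1_fset ?addr0 // => l.
  by rewrite in_fsetD1 kE => /andP[/negbTE -> _].
rewrite (gcoef_out kg) mulr0 big1_fset // => l lg _; rewrite kE.
by case: eqP => // lk; rewrite -lk lg in kg.
Qed.

Lemma mem_gsupp f m : (m \in gsupp f) = (gcoef f m != 0).
Proof. by rewrite /gsupp mem_finsupp. Qed.

Lemma gmono01 : gmono 0 1 = 1 :> gralg K G.
Proof. by []. Qed.

Lemma gmono1N m : gmono m 1 * gmono (- m) 1 = 1 :> gralg K G.
Proof. by rewrite gmonoM subrr mulr1. Qed.

Lemma gmonoX m c q : gmono m c ^+ q = gmono (m *+ q) (c ^+ q).
Proof.
elim: q => [|q IHq]; first by rewrite mulr0n !expr0.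
by rewrite !exprS IHq gmonoM mulrS.
Qed.

Lemma gcoefM_neq0 f g k : gcoef (f * g) k != 0 ->
  exists2 m, gcoef f m != 0 & gcoef g (k - m) != 0.
Proof.
rewrite gcoefM => fgk; apply/not_exists2P => fg0; move/eqP: fgk; apply.
apply: big1_seq => m _; have [-> //|/eqP f0] := eqVneq (gcoef f m) 0.
  by rewrite mul0r.
have [-> |/eqP g0] := eqVneq (gcoef g (k - m)) 0; first by rewrite mulr0.
by have [] := fg0 m; move/negP; rewrite ?(introN eqP f0) ?(introN eqP g0).
Qed.

End GroupAlgebraMore.

(** * Lattice points *)

Section Lattice.
Variables (n : nat) (r : 'I_n.+1 -> nat).
Implicit Types (m k : expo r) (a b : int_family r).

Lemma chainD (V : zmodType) (x y : {ffun Defs.coord r -> V}) i j :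
  chain (x + y) i j = chain x i j + chain y i j.
Proof.
by case: j => [|j] /=; [rewrite ffunE|case: insub => [?|] /=; rewrite ?ffunE ?addr0].
Qed.

Lemma sigmaD m k i j : sigma (m + k) (i := i) j = sigma m j + sigma k j.
Proof. by rewrite /sigma !chainD opprD addrACA. Qed.

Lemma sigma0 i j : sigma (0 : expo r) (i := i) j = 0.
Proof. by apply: (@addIr _ (sigma (0 : expo r) j)); rewrite -sigmaD !add0r. Qed.

Lemma sigmaN m i j : sigma (- m) (i := i) j = - sigma m j.
Proof. by apply: (@addIr _ (sigma m j)); rewrite -sigmaD !addNr sigma0. Qed.

Lemma sigmaB m k i j : sigma (m - k) (i := i) j = sigma m j - sigma k j.
Proof. by rewrite sigmaD sigmaN. Qed.

Lemma sigmaMn m q i j : sigma (m *+ q) (i := i) j = sigma m j *+ q.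
Proof. by elim: q => [|q IHq]; rewrite ?sigma0 // !mulrS sigmaD IHq. Qed.

Lemma sum_sigma (V : zmodType) (x : Defs.coord r -> V) i :
  \sum_j sigma x (i := i) j = x None.
Proof. by rewrite -[RHS]/(chain x i 0) (@chain_sum n r V x i 0). Qed.

Definition integral m := forall v, m v \is a Num.int.

Lemma integral0 : integral 0.
Proof. by move=> v; rewrite ffunE rpred0. Qed.

Lemma integralD m k : integral m -> integral k -> integral (m + k).
Proof. by move=> im ik v; rewrite ffunE rpredD. Qed.

Lemma integralN m : integral m -> integral (- m).
Proof. by move=> im v; rewrite ffunE rpredN. Qed.

Lemma integralB m k : integral m -> integral k -> integral (m - k).
Proof. by move=> im ik; apply/integralD/integralN. Qed.

Lemma integral_sigma m i j : integral m -> sigma m (i := i) j \is a Num.int.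
Proof.
move=> mint; suff cint l : chain m i l \is a Num.int by rewrite rpredB.
by case: l => [|l] /=; [exact: mint|case: insub => [k|] //=; exact: rpred0].
Qed.

(** The entries of the chain of a row are recovered as the partial sums of its
    values [sigma] from the end; that all rows have the sum [s] makes them agree
    on their common first entry [x_0]. *)
Lemma sigma_surj (v : int_family r) (s : int) :
  (forall i, \sum_j v i j = s) ->
  exists2 m, integral m & forall i j, sigma m (i := i) j = (v i j)%:~R.
Proof.
move=> vs; pose tail i l : int := \sum_(k < (r i).+1 | (l <= k)%N) v i k.
pose m : expo r := [ffun k => (oapp (fun w : {i : 'I_n.+1 & 'I_(r i)} =>
   tail (tag w) (tagged w).+1) s k)%:~R].
have cE i l : chain m i l = (tail i l)%:~R.
  case: l => [|l] /=; first by rewrite ffunE /= -(vs i); congr _%:~R.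
  case: insubP => [k _ <-|lr] /=; first by rewrite ffunE.
  rewrite /tail big1 // => k kl; have := ltn_ord k.
  by rewrite ltnS leqNgt (leq_ltn_trans _ kl) // leqNgt.
exists m => [k|i j]; first by rewrite ffunE intr_int.
rewrite /sigma !cE -rmorphB; congr _%:~R; rewrite /tail.
rewrite (bigD1 j) //= -addrA -[RHS]addr0; congr (_ + _); apply/eqP.
by rewrite subr_eq0; apply/eqP/eq_bigl => k; rewrite ltn_neqAle andbC eq_sym.
Qed.

(** Linear equivalence of divisors: the [a i j] are coefficients at the
    torus-invariant prime divisors of [R], and the [sigma m] are those of the
    divisor of the monomial [x^m]. *)
Definition same_class a b :=
  exists2 m, integral m & forall i j, sigma m (i := i) j = (b i j)%:~R - (a i j)%:~R.

Lemma same_class_sym a b : same_class a b -> same_class b a.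
Proof.
case=> m mint mE; exists (- m); first exact: integralN.
by move=> i j; rewrite sigmaN mE opprB.
Qed.

Lemma same_classP a b :
  same_class a b <->
  forall i, \sum_j b i j - \sum_j a i j = \sum_j b ord_max j - \sum_j a ord_max j.
Proof.
split=> [[m mint mE] i|ab].
  have E i' : (\sum_j b i' j - \sum_j a i' j)%:~R = m None.
    rewrite rmorphB !rmorph_sum /= -sumrB -(sum_sigma m i').
    by apply: eq_bigr => j _; rewrite mE.
  by apply/eqP; rewrite -(eqr_int rat) !E.
have [m mint mE] := @sigma_surj (fun i j => b i j - a i j) _
  (fun i => etrans (sumrB _ _ _ _) (ab i)).
by exists m => // i j; rewrite mE rmorphB.
Qed.

(** Every row has at least two entries, so slack can be added away from [j] to
    equalize the row sums, as [sigma_surj] demands. *)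
Lemma lattice_point_tight a (hr : forall i, (1 <= r i)%N) i (j : 'I_(r i).+1) :
  exists2 m, lattice_points a m & sigma m j = (a i j)%:~R.
Proof.
pose s : int := \sum_i' `|\sum_j' a i' j'|.
(* the place of the slack in row [i'], chosen different from [j] in row [i] *)
pose t i' : 'I_(r i').+1 := if (val j == 0)%N then ord_max else ord0.
pose e i' := s - \sum_j' a i' j'.
have e_ge0 i' : 0 <= e i'.
  rewrite /e subr_ge0 (le_trans (ler_norm _)) // /s (bigD1 i') //= lerDl.
  by apply: sumr_ge0 => *; rewrite normr_ge0.
have [|m mint mE] := @sigma_surj (fun i' j' => a i' j' + e i' *+ (j' == t i')) s.
  move=> i'; have slack : \sum_j' e i' *+ (j' == t i') = e i'.
    rewrite (bigD1 (t i')) //= eqxx big1 ?addr0 // => j' /negbTE.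
    by move=> ->.
  by rewrite big_split /= slack addrC subrK.
exists m; first split=> // i' j'.
  by rewrite mE ler_int lerDl mulrn_wge0.
rewrite mE; congr _%:~R; rewrite (_ : (j == t i) = false) ?mulr0n ?addr0 //.
rewrite /t -val_eqE; case: (val j =P 0%N) => [-> /=|/eqP/negbTE ->//].
by rewrite eq_sym; apply/negbTE; rewrite -lt0n hr.
Qed.

End Lattice.

(** * Isomorphisms of submodules *)

Section SubIso.
Variables (A : comNzRingType) (S : set A).

Definition submod_closed_set (V : lmodType A) (P : set V) :=
  [/\ forall x y, P x -> P y -> P (x + y) & forall s x, S s -> P x -> P (s *: x)].

Lemma sub_iso_inv (V W : lmodType A) (P : set V) (Q : set W) :
  submod_closed_set P -> sub_iso S P Q ->
  exists (phi : V -> W) (psi : W -> V),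
   [/\ [/\ forall x, P x -> Q (phi x), forall y, Q y -> P (psi y),
        forall x, P x -> psi (phi x) = x & forall y, Q y -> phi (psi y) = y],
       (forall x y, P x -> P y -> phi (x + y) = phi x + phi y) /\
       (forall s x, S s -> P x -> phi (s *: x) = s *: phi x) &
       (forall x y, Q x -> Q y -> psi (x + y) = psi x + psi y) /\
       (forall s x, S s -> Q x -> psi (s *: x) = s *: psi x)].
Proof.
move=> [PD PZ] [phi [[PQ inj phisurj] phiD phiZ]].
pose psi y := xget 0 [set x | P x /\ phi x = y].
have psiP y : Q y -> P (psi y) /\ phi (psi y) = y.
  by move=> /phisurj[x Px xy]; apply: (@xgetPex _ 0 [set x | P x /\ phi x = y]); exists x.
have phiI x y : P x -> P y -> phi x = phi y -> x = y.
  by move=> Px Py; apply: inj; rewrite in_setE.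
exists phi, psi; split; split=> //.
- by move=> y /psiP[].
- by move=> x Px; have [? ?] := psiP _ (PQ x Px); apply: phiI.
- by move=> y /psiP[].
- move=> x y Qx Qy; have [Px xE] := psiP _ Qx; have [Py yE] := psiP _ Qy.
  have [|Pxy xyE] := psiP (x + y); first by rewrite -xE -yE -phiD //; apply/PQ/PD.
  by apply: phiI => //; [exact: PD|rewrite phiD // xyE xE yE].
- move=> s x Ss Qx; have [Px xE] := psiP _ Qx.
  have [|Psx sxE] := psiP (s *: x); first by rewrite -xE -phiZ //; apply/PQ/PZ.
  by apply: phiI => //; [exact: PZ|rewrite phiZ // sxE xE].
Qed.

Lemma sub_iso_refl (V : lmodType A) (P : set V) : sub_iso S P P.
Proof.
exists id; split=> //; split=> [//|x y _ _ //|x Px].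
by exists x.
Qed.

Lemma sub_iso_sym (V W : lmodType A) (P : set V) (Q : set W) :
  submod_closed_set P -> sub_iso S P Q -> sub_iso S Q P.
Proof.
move=> cP /(sub_iso_inv cP)[phi [psi [[PQ QP phiK psiK] _ [psiD psiZ]]]].
exists psi; split=> //; split=> // [x y|x Px].
  by rewrite !in_setE => Qx Qy xy; rewrite -(psiK x) // xy psiK.
by exists (phi x); [exact: PQ|exact: phiK].
Qed.

Lemma sub_iso_trans (V W X : lmodType A) (P : set V) (Q : set W) (Y : set X) :
  sub_iso S P Q -> sub_iso S Q Y -> sub_iso S P Y.
Proof.
move=> [f [[PQ finj fsurj] fD fZ]] [g [[QY ginj gsurj] gD gZ]].
exists (g \o f); split.
- split; first by move=> x /PQ /QY.
  + move=> x y; rewrite !in_setE => Px Py fxy.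
    apply: finj; rewrite ?in_setE //.
    by apply: ginj; rewrite ?in_setE //; apply: PQ.
  + by move=> y /gsurj[x /fsurj[z Pz <-] <-]; exists z.
- by move=> x y Px Py /=; rewrite fD // gD //; apply: PQ.
- by move=> s x Ss Px /=; rewrite fZ // gZ //; apply: PQ.
Qed.

End SubIso.

(** * Homomorphisms between divisorial ideals *)

Section Ideals.
Variables (n : nat) (r : 'I_n.+1 -> nat) (hr : forall i, (1 <= r i)%N).
Variable K : fieldType.
Local Notation A := (gralg K (expo r)).
Local Notation T := (@divisorial n r K).
Implicit Types (f g : A) (m : expo r) (a b : int_family r).

Lemma lattice_pointsD a b m k : lattice_points a m -> lattice_points b k ->
  lattice_points (fun i j => a i j + b i j) (m + k).
Proof.
move=> [mint ma] [kint kb]; split=> [|i j]; first exact: integralD.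
by rewrite sigmaD rmorphD; apply: lerD; [exact: ma|exact: kb].
Qed.

Lemma divisorialP a f :
  T a f <-> forall m, gcoef f m != 0 -> lattice_points a m.
Proof.
split=> [[N [s [x [sx ->]]]] m|fa].
  apply: contraPP => mNa; apply/negP/negPn/eqP.
  rewrite gcoef_sum big1 // => i _; have [si [k ka <-]] := sx i.
  rewrite mulrC gcoef_monoM mul1r; apply/eqP/negP => /negP /si sk; apply: mNa.
  rewrite -(subrK k m) addrC; have [mint mle] := lattice_pointsD ka sk.
  by split=> // i' j'; have := mle i' j'; rewrite addr0.
pose s := gsupp f.
exists (size s), (fun i => gmono 0 (gcoef f (nth 0 s i))),
  (fun i => gmono (nth 0 s i) 1); split=> [i|].
  split=> [m|]; last first.
    exists (nth 0 s i) => //; apply: fa; rewrite -mem_gsupp mem_nth //.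
  rewrite gmonoE; case: (m =P 0) => [-> _|_]; last by rewrite mulr0n eqxx.
  by split=> [|i' j']; [exact: integral0|rewrite sigma0].
rewrite {1}(gralgE_wide (fsubset_refl s)) (big_nth 0) big_mkord.
by apply: eq_bigr => i _; rewrite gmonoM add0r mulr1.
Qed.

Lemma divisorial0 a : T a 0.
Proof. by apply/divisorialP => m; rewrite gcoef0 eqxx. Qed.

Lemma divisorialD a f g :
  T a f -> T a g -> T a (f + g).
Proof.
move=> /divisorialP fa /divisorialP ga; apply/divisorialP => m; rewrite gcoefD.
have [f0|f0 _] := eqVneq (gcoef f m) 0; last exact: fa.
by rewrite f0 add0r; apply: ga.
Qed.

Lemma divisorialM a s f :
  toric_ring s -> T a f -> T a (s * f).
Proof.
move=> s0 /divisorialP fa; apply/divisorialP => m /gcoefM_neq0[k sk fk].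
rewrite -(subrK k m).
have [mint mle] := lattice_pointsD (fa _ fk) (s0 _ sk).
by split=> // i j; have := mle i j; rewrite addr0.
Qed.

Lemma divisorial_mono a m c : lattice_points a m -> T a (gmono m c).
Proof.
move=> am; apply/divisorialP => k; rewrite gmonoE.
by case: (k =P m) => [->//|_]; rewrite mulr0n eqxx.
Qed.

Lemma toric_mono m c : lattice_points (fun _ _ => 0) m ->
  toric_ring (gmono m c : A).
Proof. by move=> m0; apply/divisorialP/divisorial_mono. Qed.

Lemma toric_const c : toric_ring (gmono 0 c : A).
Proof.
by apply: toric_mono; split=> [|i j]; [exact: integral0|rewrite sigma0].
Qed.

(** Every [R]-linear map [T(a) -> T(b)] is multiplication by some [g]: two
    monomials of [T(a)] have a common monomial multiple, so the quotient
    [phi(x^m) / x^m] is independent of [m].  As every bound of [T(a)] is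
    attained, [g] lies in [T(b - a)]. *)
Lemma divisorial_hom a b (phi : A -> A) :
  (forall f, T a f -> T b (phi f)) ->
  (forall f g, T a f -> T a g ->
     phi (f + g) = phi f + phi g) ->
  (forall s f, toric_ring s -> T a f -> phi (s * f) = s * phi f) ->
  exists2 g : A, forall f, T a f -> phi f = g * f &
    T (fun i j => b i j - a i j) g.
Proof.
move=> phib phiD phiZ.
have [m0 am0 _] := lattice_point_tight a hr (ord0 : 'I_(r ord0).+1).
pose g := gmono (- m0) 1 * phi (gmono m0 1).
have phi_mono m : lattice_points a m -> phi (gmono m 1) = g * gmono m 1.
  (* [x^w] is a common multiple of [x^m] and [x^m0] *)
  move=> am; have [w [wint ww] _] := lattice_point_tight (fun i j =>
    Num.ceil (Num.max (sigma m j) (sigma m0 j))) hr (ord0 : 'I_(r ord0).+1).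
  have wge i j : Num.max (sigma m j) (sigma m0 j) <= sigma w (i := i) j.
    exact: le_trans (ceil_ge _) (ww i j).
  have E u : lattice_points a u -> (forall i j, sigma u (i := i) j <= sigma w j) ->
      phi (gmono w 1) = gmono (w - u) 1 * phi (gmono u 1).
    move=> au uw; rewrite -phiZ; last exact: divisorial_mono.
      by rewrite gmonoM subrK mulr1.
    apply: toric_mono; split=> [|i j].
      by apply: integralB => //; case: au.
    by rewrite sigmaB subr_ge0.
  have Em : phi (gmono w 1) = gmono (w - m) 1 * phi (gmono m 1).
    by apply: E => // i j; have := wge i j; rewrite ge_max => /andP[].
  have Em0 : phi (gmono w 1) = gmono (w - m0) 1 * phi (gmono m0 1).
    by apply: E => // i j; have := wge i j; rewrite ge_max => /andP[].
  have -> : phi (gmono m 1) = gmono (m - w) 1 * phi (gmono w 1).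
    by rewrite Em mulrA gmonoM mulr1 addrA subrK subrr mul1r.
  rewrite Em0 mulrA gmonoM mulr1 addrA subrK /g [RHS]mulrC mulrA gmonoM.
  by rewrite mulr1.
have phi0 : phi 0 = 0.
  have := phiD 0 0 (divisorial0 a) (divisorial0 a).
  by rewrite addr0 => /eqP; rewrite -subr_eq0 opprD addNKr oppr_eq0 => /eqP.
have phig f : T a f -> phi f = g * f.
  move=> /divisorialP fa; rewrite (gralgE_wide (fsubset_refl (gsupp f))).
  have {fa} : {in gsupp f : seq _, forall m, lattice_points a m}.
    by move=> m; rewrite mem_gsupp; apply: fa.
  elim: (enum_fset (gsupp f)) => [|m s IHs] sa.
    by rewrite !big_nil mulr0.
  have am : lattice_points a m by apply: sa; rewrite mem_head.
  have {}sa : {in s, forall m, lattice_points a m}.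
    by move=> k ks; apply: sa; rewrite in_cons ks orbT.
  rewrite !big_cons phiD; last first.
  - rewrite big_seq; elim/big_ind: _ => [|x y|k ks]; first exact: divisorial0.
      exact: divisorialD.
    exact/divisorial_mono/sa.
  - exact: divisorial_mono.
  rewrite mulrDr -IHs //; congr (_ + _).
  have -> c : gmono m c = gmono 0 c * gmono m 1 :> A by rewrite gmonoM add0r mulr1.
  rewrite phiZ; [|exact: toric_const|exact: divisorial_mono].
  by rewrite phi_mono // mulrCA.
exists g => //; apply/divisorialP => u gu.
have hb m : lattice_points a m -> lattice_points b (u + m).
  move=> am; have /divisorialP := phib _ (divisorial_mono 1 am); apply.
  by rewrite phi_mono // mulrC gcoef_monoM mul1r addrK.
split=> [|i j].
  rewrite -(addrK m0 u); apply: integralB; last by case: am0.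
  by case: (hb _ am0).
have [m am mE] := lattice_point_tight a hr j.
by have [_ /(_ i j)] := hb _ am; rewrite sigmaD mE rmorphB lerBlDr.
Qed.

(** The inequalities [sigma u >= b - a] and [sigma (m - u) >= c - b] add up to the
    equality [sigma m = c - a], so both are equalities.  This is how an
    isomorphism class is detected by a single coefficient of a composition
    [T(a) -> T(b) -> T(c)]. *)
Lemma tight_exponents a b c g h m u :
  T (fun i j => b i j - a i j) g ->
  T (fun i j => c i j - b i j) h ->
  (forall i j, sigma m (i := i) j = (c i j)%:~R - (a i j)%:~R) ->
  gcoef g u != 0 -> gcoef h (m - u) != 0 ->
  integral u /\ forall i j, sigma u (i := i) j = (b i j)%:~R - (a i j)%:~R.
Proof.
move=> /divisorialP ga /divisorialP ha mE /ga[uint ub] /ha[_ mub].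
split=> // i j; apply/eqP; rewrite eq_le.
have := ub i j; rewrite rmorphB => ->; rewrite andbT.
by have := mub i j; rewrite sigmaB mE rmorphB; lra.
Qed.

(** If an isomorphism and its inverse are the multiplications by [g] and [h], the
    constant term of [h * g = 1] comes from opposite exponents of [g] and [h], at
    which all bounds must be attained. *)
Lemma ideal_iso_same_class a b :
  ideal_iso (@toric_ring n r K) (T a) (T b) <->
  same_class a b.
Proof.
have cl a' : @submod_closed_set A (@toric_ring n r K) A^o (T a').
  by split; [exact: divisorialD|exact: divisorialM].
split=> [iso|[m mint mE]].
  have [phi [psi [[PQ QP phiK psiK] [phiD phiZ] [psiD psiZ]]]] :=
    sub_iso_inv (cl a) iso.
  have [g phig ga] := divisorial_hom PQ phiD phiZ.
  have [h psih hb] := divisorial_hom QP psiD psiZ.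
  have [m0 am0 _] := lattice_point_tight a hr (ord0 : 'I_(r ord0).+1).
  have hg1 : h * g = 1.
    have am := divisorial_mono 1 am0.
    have := phiK _ am; rewrite psih; last exact: PQ.
    move=> E; have : h * phi (gmono m0 1) * gmono (- m0) 1 = 1 by rewrite E gmono1N.
    by rewrite phig // mulrA -mulrA gmono1N mulr1.
  have : gcoef (g * h) 0 != 0.
    by rewrite mulrC hg1 -gmono01 gmonoE eqxx mulr1n oner_eq0.
  move=> /gcoefM_neq0[u gu hu].
  have [|uint uE] := tight_exponents ga hb _ gu hu; last by exists u.
  by move=> i j; rewrite sigma0 subrr.
exists (fun f => gmono m 1 * f); split; last first.
- by move=> s f _ _; rewrite /GRing.scale /= mulrCA.
- by move=> f g _ _; rewrite mulrDr.
have shift a' b' k f : integral k ->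
    (forall i j, sigma k (i := i) j = (b' i j)%:~R - (a' i j)%:~R) ->
    T a' f -> T b' (gmono k 1 * f).
  move=> kint kE /divisorialP fa; apply/divisorialP => u.
  rewrite gcoef_monoM mul1r => /fa[uint ua]; split.
    by rewrite -(subrK k u); apply: integralD.
  by move=> i j; have := ua i j; rewrite sigmaB kE; lra.
split=> [f|f g _ _ fg|f fb]; first exact: shift.
  by rewrite -(mul1r f) -(mul1r g) -(gmono1N K m) mulrAC fg mulrAC.
exists (gmono (- m) 1 * f); last by rewrite mulrA gmono1N mul1r.
apply: shift fb; first exact: integralN.
by move=> i j; rewrite sigmaN mE opprB.
Qed.

(** * Uniqueness of the multiplicities *)

Definition inj_summand l (k : 'I_l) f : {ffun 'I_l -> A^o} :=
  [ffun k' => if k' == k then f else 0].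

Lemma inj_summandE l (v : {ffun 'I_l -> A^o}) :
  v = \sum_k inj_summand k (v k).
Proof.
apply/ffunP => k; rewrite sum_ffunE (bigD1 k) //= !ffunE eqxx big1 ?addr0 //.
by move=> k' /negbTE kk'; rewrite ffunE eq_sym kk'.
Qed.

Lemma inj_summandD l (k : 'I_l) f g :
  inj_summand k (f + g) = inj_summand k f + inj_summand k g.
Proof. by apply/ffunP => k'; rewrite !ffunE; case: ifP; rewrite ?addr0. Qed.

Lemma inj_summandZ l (k : 'I_l) (s f : A) :
  inj_summand k (s * f) = s *: inj_summand k f.
Proof. by apply/ffunP => k'; rewrite !ffunE; case: ifP; rewrite ?scaler0. Qed.

Section DirectSums.
Variables (l : nat) (a : 'I_l -> int_family r).
Local Notation P := (direct_sum (fun k => T (a k))).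

Lemma direct_sum_closed :
  @submod_closed_set A (@toric_ring n r K) {ffun 'I_l -> A^o} P.
Proof.
split=> [x y Px Py k|s x Ss Px k]; rewrite !ffunE.
  exact: divisorialD (Px k) (Py k).
exact: divisorialM Ss (Px k).
Qed.

Lemma direct_sum_inj k f : T (a k) f -> P (inj_summand k f).
Proof.
by move=> fa k'; rewrite ffunE; case: eqP => [->//|_]; apply: divisorial0.
Qed.

Lemma direct_sum_additive (W : zmodType) (phi : {ffun 'I_l -> A^o} -> W) :
  (forall x y, P x -> P y -> phi (x + y) = phi x + phi y) ->
  forall v, P v -> phi v = \sum_k phi (inj_summand k (v k)).
Proof.
move=> phiD v Pv; rewrite {1}(inj_summandE v).
have P0 : P 0 by move=> k; rewrite ffunE; apply: divisorial0.
elim: (index_enum _) => [|k s IHs]; last first.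
  rewrite !big_cons phiD ?IHs //; first exact: direct_sum_inj (Pv k).
  elim/big_ind: _ => // [x y|k' _]; first by have [+ _] := direct_sum_closed; exact.
  exact: direct_sum_inj (Pv k').
rewrite !big_nil; have := phiD 0 0 P0 P0.
by rewrite addr0 => /eqP; rewrite -subr_eq0 opprD addNKr oppr_eq0 => /eqP.
Qed.

End DirectSums.

(** The components [T(a k) -> T(b k')] of the map are multiplications by
    [divisorial_hom]; they form the matrix [G]. *)
Lemma direct_sum_hom l l' (a : 'I_l -> int_family r) (b : 'I_l' -> int_family r)
    (phi : {ffun 'I_l -> A^o} -> {ffun 'I_l' -> A^o}) :
  (forall v, direct_sum (fun k => T (a k)) v ->
     direct_sum (fun k => T (b k)) (phi v)) ->
  (forall v w, direct_sum (fun k => T (a k)) v ->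
     direct_sum (fun k => T (a k)) w -> phi (v + w) = phi v + phi w) ->
  (forall s v, toric_ring s -> direct_sum (fun k => T (a k)) v ->
     phi (s *: v) = s *: phi v) ->
  exists G : 'I_l' -> 'I_l -> A,
    (forall k' k, T (fun i j => b k' i j - a k i j) (G k' k)) /\
    (forall v, direct_sum (fun k => T (a k)) v ->
       forall k', phi v k' = \sum_k G k' k * v k).
Proof.
move=> phiPQ phiD phiZ.
have /choice[G GP] (kk : 'I_l' * 'I_l) : exists g : A,
    (forall f, T (a kk.2) f -> phi (inj_summand kk.2 f) kk.1 = g * f) /\
    T (fun i j => b kk.1 i j - a kk.2 i j) g.
  case: kk => k' k /=.
  have [||| g gE gab] := @divisorial_hom (a k) (b k')
    (fun f => phi (inj_summand k f) k'); last by exists g.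
  - by move=> f fa; apply: phiPQ; apply: direct_sum_inj.
  - move=> f g fa ga; rewrite inj_summandD phiD ?ffunE //; exact: direct_sum_inj.
  - move=> s f s0 fa; rewrite inj_summandZ phiZ ?ffunE //; exact: direct_sum_inj.
exists (fun k' k => G (k', k)); split=> [k' k|v Pv k'].
  by have [] := GP (k', k).
rewrite (direct_sum_additive phiD Pv) sum_ffunE; apply: eq_bigr => k _.
by have [-> //] := GP (k', k); apply: Pv.
Qed.

(** The Krull-Schmidt argument.  Mutually inverse isomorphisms are matrices [G]
    and [H] over the group algebra.  Restricting them to the summands of the
    given class and keeping, in each entry, only the coefficient at the exponent
    that realizes the isomorphism between the two summands, one gets matrices
    over [K]; they are still inverse on one side, because a summand of another
    class never contributes to such a coefficient of [H *m G]. *)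
Lemma direct_sum_iso_class_le l l' (a : 'I_l -> int_family r)
    (b : 'I_l' -> int_family r) c :
  @sub_iso A (@toric_ring n r K) {ffun 'I_l -> A^o} {ffun 'I_l' -> A^o}
     (direct_sum (fun k => T (a k)))
     (direct_sum (fun k => T (b k))) ->
  (#|[set k | `[< same_class c (a k) >]]%SET| <=
   #|[set k | `[< same_class c (b k) >]]%SET|)%N.
Proof.
move=> /(sub_iso_inv (direct_sum_closed a)).
move=> [phi [psi [[PQ QP phiK _] [phiD phiZ] [psiD psiZ]]]].
have [G [Gdeg GE]] := direct_sum_hom PQ phiD phiZ.
have [H [Hdeg HE]] := direct_sum_hom QP psiD psiZ.
have HG k1 k2 : \sum_k' H k1 k' * G k' k2 = (k1 == k2)%:R.
  have [m0 am0 _] := lattice_point_tight (a k2) hr (ord0 : 'I_(r ord0).+1).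
  have Pm := direct_sum_inj (divisorial_mono 1 am0).
  have := congr1 (fun v : {ffun _} => v k1) (phiK _ Pm).
  rewrite HE; last exact: PQ.
  rewrite ffunE => E.
  have {}E : \sum_k' H k1 k' * G k' k2 * gmono m0 1 = (k1 == k2)%:R * gmono m0 1.
    have -> : (k1 == k2)%:R * gmono m0 1 = (if k1 == k2 then gmono m0 1 else 0) :> A.
      by case: (k1 == k2); rewrite /= ?mulr1n ?mulr0n ?mul1r ?mul0r.
    rewrite -E; apply: eq_bigr => k' _; rewrite GE // (bigD1 k2) //= big1.
      by rewrite ffunE eqxx addr0 mulrA.
    by move=> k /negbTE kk; rewrite ffunE kk mulr0.
  rewrite -[LHS]mulr1 -(gmono1N K m0) mulrA mulr_suml E -mulrA gmono1N.
  by rewrite mulr1.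
set I := [set k | _]%SET; set I' := [set k' | _]%SET.
have classI k : k \in I -> same_class c (a k) by rewrite inE => /asboolP.
have /choice[mu muP] k : exists m, k \in I ->
    integral m /\ forall i j, sigma m (i := i) j = (a k i j)%:~R - (c i j)%:~R.
  by have [/classI[m mint mE]|_] := boolP (k \in I); [exists m|exists 0].
have /choice[nu nuP] k : exists m, k \in I' ->
    integral m /\ forall i j, sigma m (i := i) j = (b k i j)%:~R - (c i j)%:~R.
  have [|_] := boolP (k \in I'); last by exists 0.
  by rewrite inE => /asboolP[m mint mE]; exists m.
pose Gm := \matrix_(x < #|I'|, y < #|I|)
  gcoef (G (enum_val x) (enum_val y)) (nu (enum_val x) - mu (enum_val y)).
pose Hm := \matrix_(y < #|I|, x < #|I'|)
  gcoef (H (enum_val y) (enum_val x)) (mu (enum_val y) - nu (enum_val x)).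
suff : Hm *m Gm = 1%:M by apply: mulmx1_min.
apply/matrixP => y1 y2; rewrite !mxE.
set k1 := enum_val y1; set k2 := enum_val y2.
have k1I : k1 \in I by exact: enum_valP.
have k2I : k2 \in I by exact: enum_valP.
have [mu1int mu1E] := muP _ k1I; have [mu2int mu2E] := muP _ k2I.
pose m := mu k1 - mu k2.
have mE i j : sigma m (i := i) j = (a k1 i j)%:~R - (a k2 i j)%:~R.
  by rewrite sigmaB mu1E mu2E; lra.
have -> : (y1 == y2)%:R = gcoef (\sum_k' H k1 k' * G k' k2) m.
  rewrite HG -(inj_eq enum_val_inj) -/k1 -/k2 /m.
  have [->|_] := eqVneq k1 k2; last by rewrite gcoef0.
  by rewrite subrr -gmono01 gmonoE eqxx.
rewrite gcoef_sum (bigID (mem I')) /= [X in _ + X]big1 ?addr0; last first.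
  move=> k' kI; apply/eqP; apply: contraNT kI; rewrite mulrC => /gcoefM_neq0[u gu hu].
  have [uint uE] := tight_exponents (Gdeg _ _) (Hdeg _ _) mE gu hu.
  rewrite inE; apply/asboolP; exists (u + mu k2); first exact: integralD.
  by move=> i j; rewrite sigmaD uE mu2E; lra.
rewrite [RHS]big_enum_val /=; apply: eq_bigr => x _; rewrite !mxE.
set k' := enum_val x; have [nuint nuE] := nuP k' (enum_valP x).
(* the only exponent contributing to the coefficient at [m] of this product *)
pose u0 := nu k' - mu k2.
have u0E u : gcoef (G k' k2) u != 0 -> gcoef (H k1 k') (m - u) != 0 -> u = u0.
  move=> gu hu; have [uint uE] := tight_exponents (Gdeg _ _) (Hdeg _ _) mE gu hu.
  apply/ffunP/sigma_inj => i j.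
  by rewrite -/(sigma _ _) uE sigmaB nuE mu2E; lra.
have mu0 : m - u0 = mu k1 - nu k' by rewrite /m /u0 opprB addrA subrK.
rewrite [H _ _ * _]mulrC gcoefM.
have off u : u != u0 -> gcoef (G k' k2) u * gcoef (H k1 k') (m - u) = 0.
  move=> uu0; apply/eqP; rewrite mulf_eq0; apply: contraNT uu0.
  by rewrite negb_or => /andP[gu hu]; apply/eqP/u0E.
have [u0s|u0s] := boolP (u0 \in gsupp (G k' k2)).
  rewrite (big_fsetD1 u0) //= [X in _ = _ + X]big1_fset ?addr0.
    by rewrite mu0 mulrC.
  by move=> u; rewrite in_fsetD1 => /andP[/off].
rewrite [gcoef (G _ _) _](gcoef_out u0s) mulr0 big1_fset // => u us _.
by apply: off; apply: contraNneq u0s => <-.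
Qed.

End Ideals.

(** * The decomposition of the ring of roots *)

Section Decomposition.
Variables (n : nat) (r : 'I_n.+1 -> nat) (hr : forall i, (1 <= r i)%N).
Variables (K : fieldType) (p : nat) (hp : p \in [pchar K]).
Local Notation A := (gralg K (expo r)).
Local Notation T := (@divisorial n r K).
Implicit Types (f g : A) (m : expo r) (a b : int_family r).

Lemma gcoefMn f q m : gcoef (f *+ q) m = gcoef f m *+ q.
Proof. by elim: q => [|q IHq]; rewrite ?gcoef0 // !mulrS gcoefD IHq. Qed.

Lemma gralg_pchar : p \in [pchar A].
Proof.
rewrite inE (pcharf_prime hp) /=; apply/eqP/gralgP => m.
rewrite -gmono01 gcoefMn gmonoE gcoef0; case: eqP => _.
  exact: pcharf0 hp.
by rewrite mul0rn.
Qed.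

Lemma expr_pchar f e : f ^+ (p ^ e) =
  \sum_(m <- gsupp f) gmono (m *+ (p ^ e)) (gcoef f m ^+ (p ^ e)).
Proof.
have pe : [pchar A].-nat (p ^ e)%N.
  rewrite pnatX (eq_pnat _ (pcharf_eq gralg_pchar)) pnat_id ?orbT //.
  exact: pcharf_prime hp.
rewrite {1}(gralgE_wide (fsubset_refl (gsupp f))).
rewrite (big_morph (fun g : A => g ^+ (p ^ e)) (op1 := +%R) (id1 := 0)).
- by under eq_bigr do rewrite gmonoX.
- by move=> g h; exact: exprDn_pchar.
- by rewrite expr0n expn_eq0 eqn0Ngt (prime_gt0 (pcharf_prime hp)).
Qed.

Section Exponent.
Variable e : nat.
Local Notation q := (p ^ e)%N.

Lemma q_gt0 : (0 < q)%N.
Proof. by rewrite expn_gt0 (prime_gt0 (pcharf_prime hp)). Qed.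

Lemma mulrn_q_inj : injective (fun m => m *+ q).
Proof.
move=> m k /ffunP mk; apply/ffunP => v; have := mk v.
rewrite !ffunMnE => /eqP; rewrite -subr_eq0 -mulrnBl mulrn_eq0.
by rewrite eqn0Ngt q_gt0 subr_eq0 => /eqP.
Qed.

(** By Frobenius, the power [q = p^e] multiplies all exponents by [q] and raises
    the coefficients to the power [q], so no term disappears. *)
Lemma root_ring_support f :
  root_ring (@toric_ring n r K) q f <->
  forall m, gcoef f m != 0 -> lattice_points (fun _ _ => 0) (m *+ q).
Proof.
rewrite /root_ring /= expr_pchar; split=> [fq m fm|fs m].
  apply: fq; rewrite gcoef_sum (big_fsetD1 m) ?mem_gsupp //= gmonoE eqxx.
  rewrite big1_fset ?addr0 ?mulr1n ?expf_neq0 // => k.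
  rewrite in_fsetD1 gmonoE (inj_eq mulrn_q_inj) => /andP[km _] _.
  by rewrite eq_sym (negbTE km).
apply: contraPP => mN; apply/negP/negPn/eqP; rewrite gcoef_sum big1_fset //.
move=> k; rewrite mem_gsupp => /fs kq _; rewrite gmonoE.
by case: (m =P _) => [mk|_]; [rewrite mk in mN|rewrite mulr0n].
Qed.

(** The points of [((1/q) Z / Z)^d] are represented in the half-open cube
    (0, 1]^d.  With these representatives no boundary case arises when the values
    of [sigma] are rounded up: a final entry of a chain is always rounded to [1],
    and a difference of two entries always to [0] or [1]. *)
Definition grid := {ffun Defs.coord r -> 'I_q}.
Definition grid_point (x : grid) : expo r := [ffun v => (x v).+1%:R / q%:R].
Definition grid_family (x : grid) : int_family r :=
  fun i j => Num.ceil (sigma (grid_point x) j).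

Lemma q_neq0 : q%:R != 0 :> rat.
Proof. by rewrite pnatr_eq0 -lt0n q_gt0. Qed.

Lemma grid_pointMn x : integral (grid_point x *+ q).
Proof.
move=> v; rewrite ffunMnE ffunE -[_ *+ q]mulr_natr divfK ?q_neq0 //; exact: rpred_nat.
Qed.

Lemma grid_point_inj x y : integral (grid_point x - grid_point y) -> x = y.
Proof.
move=> xy; apply/ffunP => v; apply/eqP; have := xy v.
rewrite !ffunE -mulrBl => /intrP[z zE].
have q0 : 0 < q%:R :> rat by rewrite ltr0n q_gt0.
have {}zE : (x v).+1%:Z - (y v).+1%:Z = z * q%:Z.
  apply/eqP; rewrite -(eqr_int rat) rmorphB rmorphM /=; apply/eqP.
  by move/(congr1 (fun t => t * q%:R)): zE; rewrite divfK ?q_neq0.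
have := ltn_ord (x v); have := ltn_ord (y v); rewrite -val_eqE /=.
move: (val (x v)) (val (y v)) zE => k l zE lq kq.
have z0 : z = 0 by nia.
by apply/eqP; move: zE; rewrite z0 mul0r; lia.
Qed.

Lemma grid_point_ex m : integral (m *+ q) -> exists x, integral (m + grid_point x).
Proof.
move=> mq; have /choice[x xP] v : exists k : 'I_q, m v + k.+1%:R / q%:R \is a Num.int.
  have := mq v; rewrite ffunMnE => /intrP[z zE].
  have q0 : q%:Z != 0 by rewrite eqz_nat -lt0n q_gt0.
  have kq : (`|((- z - 1) %% q%:Z)%Z|%N < q)%N.
    by rewrite -ltz_nat gez0_abs ?modz_ge0 // ltz_pmod // ltz_nat q_gt0.
  exists (Ordinal kq) => /=; set k := `|_|%N.
  have kE : k%:Z = - z - 1 - ((- z - 1) %/ q%:Z)%Z * q%:Z.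
    have kE : k%:Z = ((- z - 1) %% q%:Z)%Z by rewrite /k gez0_abs ?modz_ge0.
    by rewrite kE; move: (divz_eq (- z - 1) q%:Z); lia.
  have -> : m v = z%:~R / q%:R.
    by rewrite -zE -[m v *+ q]mulr_natr mulfK ?q_neq0.
  rewrite -mulrDl.
  have -> : z%:~R + k.+1%:R = (- ((- z - 1) %/ q%:Z)%Z)%:~R * q%:R :> rat.
    have -> : k.+1%:R = (k%:Z + 1)%:~R :> rat by rewrite intrD -natr1.
    rewrite -(intrD) kE -[q%:R]/(q%:Z%:~R) -intrM; congr _%:~R.
    by ring.
  by rewrite mulfK ?q_neq0 // intr_int.
exists [ffun v => x v] => v; rewrite !ffunE; exact: xP.
Qed.

Definition gfilter (P : pred (expo r)) f : A :=
  \sum_(m <- gsupp f | P m) gmono m (gcoef f m).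

Lemma gfilterE P f m : gcoef (gfilter P f) m = if P m then gcoef f m else 0.
Proof.
rewrite gcoef_sum; under eq_bigr do rewrite gmonoE.
have [fm|fm] := boolP (m \in gsupp f); last first.
  rewrite (gcoef_out fm) if_same big1_seq // => k /andP[_ kf].
  by case: (m =P k) => [mk|_]; [rewrite mk kf in fm|rewrite mulr0n].
rewrite big_mkcond (big_fsetD1 m) //= big1_seq; last first.
  move=> k; rewrite in_fsetD1 eq_sym => /andP[_ /andP[/negbTE -> _]].
  by rewrite mulr0n if_same.
by rewrite eqxx mulr1n addr0.
Qed.

Definition grid_index := 'I_#|grid|.

(** The isomorphism is constructed from the direct sum to [R^{1/q}] because its
    linearity is evident in this direction. *)
Definition glue (v : {ffun grid_index -> A^o}) : A^o :=
  \sum_k gmono (- grid_point (enum_val k)) 1 * v k.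

Lemma glueE v m : gcoef (glue v) m =
  \sum_k gcoef (v k : A) (m + grid_point (enum_val k)).
Proof.
by rewrite gcoef_sum; apply: eq_bigr => k _; rewrite gcoef_monoM mul1r opprK.
Qed.

Local Notation P := (direct_sum (fun k : grid_index => T (grid_family (enum_val k)))).

Lemma glue_component v k m : P v -> integral m ->
  gcoef (glue v) (m - grid_point (enum_val k)) = gcoef (v k : A) m.
Proof.
move=> Pv mint; rewrite glueE (bigD1 k) //= subrK big1 ?addr0 // => k' kk'.
apply/eqP; apply: contraNT kk' => vk'.
have /divisorialP/(_ _ vk')[mxint _] := Pv k'.
apply/eqP/enum_val_inj/grid_point_inj.
have -> : grid_point (enum_val k') - grid_point (enum_val k) =
  m - grid_point (enum_val k) + grid_point (enum_val k') - m.
  by rewrite [RHS]addrAC [m - _]addrC addrK addrC.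
exact: integralB.
Qed.

(** The exponents of [R] are integral, so the terms of an element of [R^{1/q}] with
    exponents in one class modulo [Z^d] form a summand.  Shifting the class of
    [-x] to [Z^d] turns the condition [sigma >= 0] into [sigma >= sigma x], whose
    integral solutions are the exponents of the ideal with bounds
    [ceil (sigma x)]. *)
Lemma root_ring_decomposition :
  @sub_iso A (@toric_ring n r K) {ffun grid_index -> A^o} A^o P
    (root_ring (@toric_ring n r K) q).
Proof.
have q0 : 0 < q%:R :> rat by rewrite ltr0n q_gt0.
exists glue; split; last first.
- move=> s v _ _; rewrite /glue scaler_sumr; apply: eq_bigr => k _.
  by rewrite ffunE /GRing.scale /= mulrCA.
- move=> v w _ _; rewrite /glue -big_split /=; apply: eq_bigr => k _.
  by rewrite ffunE mulrDr.
split=> [v Pv|v w|f /root_ring_support fN].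
- apply/root_ring_support => m; rewrite glueE => vm.
  have [k vk] : exists k, gcoef (v k : A) (m + grid_point (enum_val k)) != 0.
    apply/existsP; apply: contraNT vm; rewrite negb_exists => /forallP v0.
    by apply/eqP/big1 => k _; apply/eqP/negPn/v0.
  have /divisorialP/(_ _ vk)[Mint Mle] := Pv k; set x := grid_point _ in Mint Mle.
  split=> [|i j].
    have -> : m *+ q = (m + x) *+ q - x *+ q by rewrite mulrnDl addrK.
    apply: integralB; last exact: grid_pointMn.
    by move=> u; rewrite ffunMnE rpredMn.
  rewrite sigmaMn mulrn_wge0 //; have := Mle i j.
  by rewrite sigmaD /grid_family -/x; have := ceil_ge (sigma x j); lra.
- rewrite !in_setE => Pv Pw vw; apply/ffunP => k; apply/gralgP => m.
  have [mint|mNint] := pselect (integral m).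
    by rewrite -!glue_component // vw.
  have out u : P u -> gcoef (u k : A) m = 0.
    move=> Pu; apply/eqP/negPn/negP => um.
    by have /divisorialP/(_ _ um)[mint _] := Pu k; apply: mNint.
  by rewrite !out.
pose v : {ffun grid_index -> A^o} := [ffun k =>
  gfilter (fun m => `[< integral m >]) (gmono (grid_point (enum_val k)) 1 * f)].
have vE k m : gcoef (v k : A) m =
    if `[< integral m >] then gcoef f (m - grid_point (enum_val k)) else 0.
  by rewrite ffunE gfilterE gcoef_monoM mul1r.
have Pv : P v.
  move=> k; apply/divisorialP => m; rewrite vE; case: asboolP => [mint fm|]; last first.
    by rewrite eqxx.
  have [_ /(_ _ _)mle] := fN _ fm; split=> // i j.
  rewrite -[leRHS](@ceilK rat) ?integral_sigma // ler_int le_ceil //.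
  by have := mle i j; rewrite sigmaMn pmulrn_lge0 ?q_gt0 // sigmaB subr_ge0.
exists v => //; apply/gralgP => m.
have [mq|mNq] := pselect (integral (m *+ q)).
  have [x mx] := grid_point_ex mq; pose k : grid_index := enum_rank x.
  rewrite -(addrK (grid_point x) m) -{2}(enum_rankK x) glue_component //.
  by rewrite vE asboolT // enum_rankK.
have -> : gcoef f m = 0.
  by apply/eqP/negPn/negP => /fN[mq _]; apply: mNq.
rewrite glueE big1 // => k _; rewrite vE addrK; case: asboolP => // _.
by apply/eqP/negPn/negP => /fN[mq _]; apply: mNq.
Qed.

End Exponent.
End Decomposition.

(** * The multiplicities as numbers of grid points *)

Section Multiplicity.
Variables (n : nat) (r : 'I_n.+1 -> nat) (hr : forall i, (1 <= r i)%N).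
Variables (K : fieldType) (p : nat) (hp : p \in [pchar K]) (R : realType).
Local Notation A := (gralg K (expo r)).
Local Notation T := (@divisorial n r K).
Implicit Types (a b : int_family r).

Lemma chain_ratr (x : Defs.coord r -> rat) i j :
  chain (fun v => ratr (x v) : R) i j = ratr (chain x i j).
Proof. by case: j => [|j] //=; case: insub => [k|] //=; rewrite rmorph0. Qed.

Lemma ceil_ratr (x : rat) : Num.ceil (ratr x : R) = Num.ceil x.
Proof.
by apply: ceil_def; rewrite -!(ratr_int R) ltr_rat ler_rat ceil_itv.
Qed.

Lemma conic_grid_family e (x : grid r p e) : @conic n r K R (grid_family x).
Proof.
exists (fun v => ratr (grid_point x v)).
have -> : (fun i j => Num.ceil (sigma (fun v => ratr (grid_point x v) : R) j)) =
    grid_family x.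
  apply: functional_extensionality_dep => i; apply/funext => j.
  by rewrite /sigma !chain_ratr -rmorphB ceil_ratr.
exact: sub_iso_refl.
Qed.

(** By Krull-Schmidt, the multiplicity may be read off the decomposition indexed
    by the grid. *)
Lemma multiplicityE a e : multiplicity R p (T a) e =
  #|[set x : grid r p e | `[< same_class a (grid_family x) >]]%SET|.
Proof.
pose std (k : grid_index r p e) := grid_family (enum_val k).
have isoE l (b : 'I_l -> int_family r) :
    #|[set k | `[< ideal_iso (@toric_ring n r K) (T (b k)) (T a) >]]%SET| =
    #|[set k | `[< same_class a (b k) >]]%SET|.
  apply: eq_card => k; rewrite !inE; apply/asboolP/asboolP.
    by move=> /(ideal_iso_same_class hr)/same_class_sym.
  by move=> /same_class_sym/(ideal_iso_same_class hr).
have stdE : #|[set x : grid r p e | `[< same_class a (grid_family x) >]]%SET| =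
    #|[set k | `[< same_class a (std k) >]]%SET|.
  rewrite -[LHS](on_card_preimset (onW_bij _ (@enum_val_bij (grid r p e)))).
  by apply: eq_card => k; rewrite !inE.
have dec := root_ring_decomposition r hp e.
have cl := direct_sum_closed K std.
rewrite stdE /multiplicity; set P := is_multiplicity _ _ _.
have [l [b [_ bdec ->]]] : P (xget 0%N P).
  apply: xgetPex; exists #|[set k | `[< same_class a (std k) >]]%SET|.
  exists #|grid r p e|, std; split; last by rewrite isoE.
  - by move=> k; apply: conic_grid_family.
  - exact: sub_iso_sym cl dec.
have iso := sub_iso_trans dec bdec.
rewrite isoE; apply/eqP; rewrite eqn_leq.
apply/andP; split; apply: (direct_sum_iso_class_le hr (K := K)) => //.
exact: sub_iso_sym cl iso.
Qed.

(** * Row sums and descents *)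

(** The place of the entry [x_{i,j}], with [x_{i,0} = x_0]; the default value for
    [j > r i] is never reached. *)
Definition chain_var i (j : nat) : Defs.coord r :=
  if j is j'.+1 then omap (Tagged (fun i => 'I_(r i))) (insub j' : option 'I_(r i))
  else None.

Definition row_des (y : Defs.coord r -> nat) i : nat :=
  \sum_(j < r i) (y (chain_var i j.+1) < y (chain_var i j))%N.

Lemma chain_varE (V : zmodType) (x : Defs.coord r -> V) i j :
  (j <= r i)%N -> chain x i j = x (chain_var i j).
Proof. by case: j => [|j] //= jr; rewrite insubT. Qed.

Lemma ceil_frac (q : nat) (k l : 'I_q) :
  Num.ceil (k.+1%:R / q%:R - l.+1%:R / q%:R : rat) = (l < k)%N%:Z.
Proof.
have q0 : 0 < q%:R :> rat by rewrite ltr0n (leq_ltn_trans _ (ltn_ord k)).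
rewrite -mulrBl; apply: ceil_def; rewrite ltr_pdivlMr // ler_pdivrMr //.
have [kq lq] := (ltn_ord k, ltn_ord l); move: (val k) (val l) kq lq => {}k {}l kq lq.
rewrite -[k.+1%:R]/(k.+1%:Z%:~R) -[l.+1%:R]/(l.+1%:Z%:~R) -[q%:R]/(q%:Z%:~R).
rewrite -rmorphB -!rmorphM /= ltr_int ler_int.
by case: ltnP => kl; lia.
Qed.

Lemma ceil_frac1 (q : nat) (k : 'I_q) : Num.ceil (k.+1%:R / q%:R : rat) = 1.
Proof.
have q0 : 0 < q%:R :> rat by rewrite ltr0n (leq_ltn_trans _ (ltn_ord k)).
apply: ceil_def; rewrite subrr; apply/andP; split.
  exact: divr_gt0 (ltr0Sn _ _) q0.
by rewrite ler_pdivrMr // mul1r ler_nat.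
Qed.

Lemma sum_grid_family e (x : grid r p e) i :
  \sum_j grid_family x (i := i) j = (row_des (fun v => x v) i)%:Z + 1.
Proof.
rewrite big_ord_recr /=; congr (_ + _); last first.
  rewrite /grid_family /sigma chain_varE //= insubF ?ltnn // subr0 ffunE.
  exact: ceil_frac1.
rewrite /row_des -[RHS]natz natr_sum; apply: eq_bigr => j _.
have jr := ltn_ord j.
rewrite /grid_family /sigma !chain_varE ?ffunE //=; last exact: ltnW.
by rewrite ceil_frac natz.
Qed.

Lemma sum_class_family (c : 'I_n -> int) i :
  \sum_j @class_family n r c i j = oapp c 0 (insub (val i)).
Proof.
rewrite (bigD1 ord0) //= big1 ?addr0; first by rewrite /class_family eqxx.
by move=> j /negbTE j0; rewrite /class_family j0.
Qed.

Lemma sum_class_family_widen (c : 'I_n -> int) (k : 'I_n) :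
  \sum_j @class_family n r c (widen_ord (leqnSn n) k) j = c k.
Proof.
rewrite sum_class_family; case: insubP => [k' _ kk|] /=; last by rewrite ltn_ord.
by congr c; apply: val_inj.
Qed.

Lemma sum_class_family_max (c : 'I_n -> int) :
  \sum_j @class_family n r c ord_max j = 0.
Proof. by rewrite sum_class_family insubF //= ltnn. Qed.

Definition in_class (c : 'I_n -> int) (y : Defs.coord r -> nat) :=
  [forall i : 'I_n, (row_des y (widen_ord (leqnSn n) i))%:Z -
    (row_des y ord_max)%:Z == c i].

Lemma multiplicity_class_module (c : 'I_n -> int) e :
  multiplicity R p (class_module r K c) e =
  #|[set x : grid r p e | in_class c (fun v => x v)]%SET|.
Proof.
rewrite multiplicityE; apply: eq_card => x; rewrite !inE.
apply/asboolP/forallP => [/same_classP H i|H].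
  have := H (widen_ord (leqnSn n) i).
  rewrite !sum_grid_family sum_class_family_widen sum_class_family_max; lia.
apply/same_classP => i; rewrite !sum_grid_family sum_class_family_max.
have [ni|in_] := leqP n i.
  have -> : i = ord_max by apply/val_inj/eqP; rewrite eqn_leq leq_ord.
  by rewrite sum_class_family_max.
have [k ->] : exists k : 'I_n, i = widen_ord (leqnSn n) k.
  by exists (Ordinal in_); apply: val_inj.
by have := H k; rewrite sum_class_family_widen; lia.
Qed.

End Multiplicity.

(** * Counting grid points by order type *)

Section OrderTypes.
Variables (D : finType) (d : nat) (pos : D -> 'I_d) (pos_bij : bijective pos).

Definition order_invariant (Q : (D -> nat) -> bool) :=
  forall y z : D -> nat, (forall u v, (y u < y v)%N = (z u < z v)%N) -> Q y = Q z.

Lemma card_ord_lt (m : 'I_d) : #|[set k : 'I_d | (k < m)%N]%SET| = m.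
Proof.
have md := ltnW (ltn_ord m).
rewrite cardsE -sum1_card (eq_bigl (fun k : 'I_d => k < m)%N) //.
by rewrite (big_ord_narrow md) sum1_card card_ord.
Qed.

Definition spread q (wt : 'S_d * d.-tuple 'I_q) : {ffun D -> 'I_q} :=
  [ffun v => tnth wt.2 (wt.1 (pos v))].

Lemma increasing_tnth q (t : d.-tuple 'I_q) : sorted ltn (map val t) ->
  forall k l : 'I_d, (tnth t k < tnth t l)%N = (k < l)%N.
Proof.
move=> st.
have mono (k l : 'I_d) : (k < l)%N -> (tnth t k < tnth t l)%N.
  move=> kl; have q0 : 'I_q := tnth t k.
  have := sorted_ltn_nth ltn_trans 0%N st.
  move=> /(_ k l); rewrite !inE size_map size_tuple !ltn_ord => /(_ isT isT kl).
  by rewrite !(nth_map q0) ?size_tuple ?ltn_ord // -!tnth_nth.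
move=> k l; case: (ltngtP k l) => [/mono //|lk|/val_inj ->]; last by rewrite ltnn.
by apply/negbTE; rewrite -leqNgt ltnW // mono.
Qed.

Lemma spread_ltn q w (t : d.-tuple 'I_q) u v : sorted ltn (map val t) ->
  (spread (w, t) u < spread (w, t) v)%N = (w (pos u) < w (pos v))%N.
Proof. by move=> st; rewrite !ffunE increasing_tnth. Qed.

(** The permutation is recovered as the ranks of the values. *)
Lemma spread_inj q :
  {in finset.setX [set: 'S_d]
        [set t : d.-tuple 'I_q | sorted ltn (map val t)]%SET &,
    injective (@spread q)}.
Proof.
have [inv posK invK] := pos_bij.
move=> [w t] [w' t']; rewrite !inE /= => st st' ww.
have eqw : w = w'.
  apply/permP => i; apply: val_inj => /=.
  have rank (s : 'S_d) : val (s i) = #|[set j | (s j < s i)%N]%SET|.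
    rewrite -[LHS]card_ord_lt -[LHS](card_preimset _ (@perm_inj _ s)).
    by apply: eq_card => j; rewrite !inE.
  rewrite /= in rank; rewrite (rank w) (rank w'); apply: eq_card => j; rewrite !inE.
  by rewrite -(invK i) -(invK j) -(spread_ltn _ _ _ st) ww spread_ltn.
rewrite -{w'}eqw in ww *; congr (_, _); apply: eq_from_tnth => k.
have /ffunP/(_ (inv (w^-1%g k))) := ww.
by rewrite !ffunE /= invK permKV.
Qed.

(** The injective grid functions are the compositions of a permutation with an
    increasing sequence; as this composition is injective and both sides have
    [q (q - 1) ... (q - d + 1)] elements, all of them are reached. *)
Lemma card_injective_order_type q (Q : (D -> nat) -> bool) : order_invariant Q ->
  #|[set x : {ffun D -> 'I_q} | injectiveb x && Q (fun v => x v)]%SET| =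
  (#|[set w : 'S_d | Q (fun v => w (pos v))]%SET| * 'C(q, d))%N.
Proof.
move=> invQ; have [inv posK invK] := pos_bij.
set Inc := [set t : d.-tuple 'I_q | sorted ltn (map val t)]%SET.
have spreadQ w t : t \in Inc -> Q (fun v => spread (w, t) v) = Q (fun v => w (pos v)).
  by rewrite inE => st; apply: invQ => u v; rewrite spread_ltn.
have cD : #|D| = d by rewrite (bij_eq_card pos_bij) card_ord.
have injE : (@spread q) @: finset.setX [set: 'S_d] Inc =
    [set x : {ffun D -> 'I_q} | injectiveb x]%SET.
  apply/eqP; rewrite eqEcard; apply/andP; split.
    apply/fintype.subsetP => x /imsetP[[w t]]; rewrite !inE /= => st ->.
    apply/injectiveP => u v uv; apply: (bij_inj pos_bij).
    apply: (@perm_inj _ w); apply: val_inj; apply/eqP.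
    have := spread_ltn w u v st; have := spread_ltn w v u st.
    by rewrite uv ltnn; case: ltngtP.
  rewrite (card_in_imset (@spread_inj q)) cardsX cardsT card_Sn.
  by rewrite card_ltn_sorted_tuples card_inj_ffuns cD card_ord -bin_ffact mulnC.
rewrite -(card_ltn_sorted_tuples d q) -cardsX.
rewrite -(card_in_imset (f := @spread q)); last first.
  apply: (sub_in2 _ (@spread_inj q)) => -[w t] /finset.setXP[_ tI].
  by rewrite finset.in_setX tI finset.in_setT.
congr #|pred_of_set _|; apply/setP => x; rewrite inE.
apply/andP/imsetP => [[injx Qx]|[[w t] /finset.setXP[/= wQ tI] ->]].
  have : x \in [set x : {ffun D -> 'I_q} | injectiveb x]%SET by rewrite inE.
  rewrite -injE => /imsetP[[w t] /finset.setXP[_ tI] xE]; exists (w, t) => //.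
  by rewrite finset.in_setX tI andbT inE -(spreadQ w t tI) -xE.
rewrite inE in wQ; split; last by rewrite spreadQ.
have : spread (w, t) \in [set x : {ffun D -> 'I_q} | injectiveb x]%SET.
  by rewrite -injE imset_f // finset.in_setX tI finset.in_setT.
by rewrite inE.
Qed.

(** * Asymptotic proportions of order types *)

Section Limit.
Variables (R : realType) (p : nat) (p_gt1 : (1 < p)%N).
Local Notation ratio k e := (((p ^ e) ^_ k)%:R / (p%:R ^+ (e * k)) : R).

Lemma cvg_inv_pow (c : R) : (c / p%:R ^+ e) @[e --> \oo] --> (0 : R).
Proof.
have p_gt0 := ltnW p_gt1; have := @cvg_geometric R c (p%:R^-1) _.
rewrite normfV normr_nat invf_lt1 ?ltr0n // ltr1n p_gt1 => /(_ isT).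
apply: cvg_trans; apply: near_eq_cvg; near=> e.
by rewrite /geometric /= exprVn.
Unshelve. all: by end_near. Qed.

Lemma cvg_ffact_ratio k : ratio k e @[e --> \oo] --> (1 : R).
Proof.
elim: k => [|k IHk].
  rewrite (_ : (fun e => ratio 0 e) = fun=> 1); first exact: cvg_cst.
  by apply/funext => e; rewrite muln0 expr0 ffactn0 divr1.
(* the subtraction is truncated, but the quotient lies between
   [1 - k / p ^ e] and [1] for all [e] *)
have step : ((p ^ e - k)%:R / p%:R ^+ e : R) @[e --> \oo] --> (1 : R).
  apply: (@squeeze_cvgr _ _ _ _ (fun e => 1 - k%:R / p%:R ^+ e : R) (fun=> 1 : R)).
  - near=> e.
    have pe0 : 0 < p%:R ^+ e :> R by rewrite exprn_gt0 // ltr0n ltnW.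
    rewrite ler_pdivlMr // mulrBl mul1r divfK ?gt_eqF // ler_pdivrMr // mul1r.
    rewrite -natrX ler_nat leq_subr andbT lerBlDr -natrD ler_nat.
    by rewrite addnC -leq_subLR.
  - rewrite -[X in _ --> X]subr0; apply: cvgB; first exact: cvg_cst.
    exact: cvg_inv_pow.
  - exact: cvg_cst.
rewrite -[X in _ --> X]mulr1; apply: cvg_trans (cvgM IHk step).
apply: near_eq_cvg; near=> e.
rewrite ffactnSr natrM mulnS addnC exprD invfM /=.
by rewrite mulrACA.
Unshelve. all: by end_near. Qed.

(** Up to the non-injective points, whose proportion tends to [0], a condition
    on the order type of [d] coordinates holds for each of the [d`!] orders on
    the same number of points of the grid. *)
Lemma cvg_order_type (Q : (D -> nat) -> bool) : order_invariant Q ->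
  (#|[set x : {ffun D -> 'I_(p ^ e)} | Q (fun v => x v)]%SET|%:R /
     (p%:R ^+ (e * d)) : R) @[e --> \oo] -->
  (#|[set w : 'S_d | Q (fun v => w (pos v))]%SET|%:R / d`!%:R : R).
Proof.
move=> invQ; set V := [set w | _]%SET; pose s : R := #|V|%:R / d`!%:R.
have cD : #|D| = d by rewrite (bij_eq_card pos_bij) card_ord.
apply: (@squeeze_cvgr _ _ _ _ (fun e => s * ratio d e)
                             (fun e => s * ratio d e + (1 - ratio d e))).
- near=> e; set X := [set x | _]%SET.
  have pe0 : 0 < p%:R ^+ (e * d) :> R by rewrite exprn_gt0 // ltr0n ltnW.
  have := card_injective_order_type (p ^ e) invQ; rewrite -/V.
  set Y := [set x | _]%SET => YE.
  have YX : Y \subset X by apply/fintype.subsetP => x; rewrite !inE => /andP[].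
  have sE : s * ratio d e = #|Y|%:R / p%:R ^+ (e * d).
    rewrite YE natrM -bin_ffact natrM /s mulrA; congr (_ / _).
    by rewrite -!mulrA; congr (_ * _); rewrite mulrC mulfK // pnatr_eq0 -lt0n fact_gt0.
  (* [Y] is the intersection of [X] with the set of all injective points *)
  have XY : (#|X| + (p ^ e) ^_ d <= #|Y| + (p ^ e) ^ d)%N.
    have -> : ((p ^ e) ^_ d = #|[set x : {ffun D -> 'I_(p ^ e)} | injectiveb x]%SET|)%N.
      by rewrite card_inj_ffuns cD card_ord.
    have -> : ((p ^ e) ^ d = #|{: {ffun D -> 'I_(p ^ e)}}|)%N.
      by rewrite card_ffun cD card_ord.
    rewrite -cardsUI addnC leq_add ?max_card //.
    by apply/subset_leq_card/fintype.subsetP => x; rewrite !inE andbC.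
  rewrite sE; apply/andP; split.
    by rewrite ler_pM2r ?invr_gt0 // ler_nat subset_leq_card.
  have -> : 1 - ratio d e = (p%:R ^+ (e * d) - ((p ^ e) ^_ d)%:R) / p%:R ^+ (e * d).
    by rewrite mulrBl divff ?lt0r_neq0.
  rewrite -mulrDl ler_pM2r ?invr_gt0 //.
  by rewrite addrA lerBrDr exprM -!natrX -!natrD ler_nat.
- rewrite -[X in _ --> X]mulr1; apply: cvgM; first exact: cvg_cst.
  exact: cvg_ffact_ratio.
- rewrite -[X in _ --> X](addr0) -[X in _ + X](subrr 1); apply: cvgD.
    rewrite -[X in _ --> X]mulr1; apply: cvgM; first exact: cvg_cst.
    exact: cvg_ffact_ratio.
  by apply: cvgB; [exact: cvg_cst|exact: cvg_ffact_ratio].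
Unshelve. all: by end_near. Qed.

End Limit.
End OrderTypes.

(** * Descents of permutations *)

Section Descents.
Variables (d : nat) (w : 'S_d.+1).
Local Notation L := (letter w).

Lemma letter_inj k l : (0 < k <= d.+1)%N -> (0 < l <= d.+1)%N -> L k = L l -> k = l.
Proof.
move=> /andP[k0 kd] /andP[l0 ld] /val_inj/perm_inj/(congr1 val) /=.
by rewrite !inordK ?prednK //; case: k k0 {kd} => // k _; case: l l0 {ld} => // l _ /= ->.
Qed.

Lemma letter_ltnNge k l : (0 < k <= d.+1)%N -> (0 < l <= d.+1)%N -> k != l ->
  (L k < L l)%N = ~~ (L l < L k)%N.
Proof.
move=> kd ld kl; case: ltngtP => // /(letter_inj kd ld) kl'.
by rewrite kl' eqxx in kl.
Qed.

Lemma des_cat a b c : (a <= b <= c)%N -> des w a c = (des w a b + des w b c)%N.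
Proof. by move=> /andP[ab bc]; rewrite /des (big_cat_nat ab bc). Qed.

Lemma des1 a : des w a a.+1 = (L a.+1 < L a)%N.
Proof. by rewrite /des big_nat1. Qed.

Lemma des_geq a : des w a a = 0%N.
Proof. by rewrite /des big_geq. Qed.

Lemma des_ge a b : (a <= b)%N -> ((L b < L a)%N <= des w a b)%N.
Proof.
elim: b => [|b IHb]; first by rewrite leqn0 => /eqP->; rewrite ltnn.
rewrite leq_eqVlt => /predU1P[->|]; first by rewrite ltnn.
rewrite ltnS => ab; rewrite (@des_cat a b) ?ab ?leqnSn // des1.
have := IHb ab; move: (L a) (L b) (L b.+1) => x y z.
by case: (ltnP z x); case: (ltnP y x); case: (ltnP z y) => /=; lia.
Qed.

Lemma des_le a b : (a <= b)%N -> (des w a b + (L a < L b)%N <= b - a)%N.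
Proof.
elim: b => [|b IHb]; first by rewrite leqn0 => /eqP->; rewrite des_geq ltnn.
rewrite leq_eqVlt => /predU1P[->|]; first by rewrite des_geq ltnn.
rewrite ltnS => ab; rewrite (@des_cat a b) ?ab ?leqnSn // des1 subSn //.
have := IHb ab; move: (L a) (L b) (L b.+1) => x y z.
by case: (ltnP x z); case: (ltnP x y); case: (ltnP z y) => /=; lia.
Qed.

(** Reading a factor backwards turns its ascents into descents. *)
Lemma rev_asc_des b m : (m < b <= d.+1)%N ->
  (\sum_(j < m) (L (b - j.+1) < L (b - j))%N + des w (b - m) b = m)%N.
Proof.
elim: m => [|m IHm] /andP[mb bd]; first by rewrite big_ord0 subn0 des_geq.
have := IHm; rewrite bd ltnW // => /(_ isT) E.
set a := (b - m.+1)%N; have bm : (b - m = a.+1)%N by rewrite /a; lia.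
have step : des w a b = ((L a.+1 < L a)%N + des w a.+1 b)%N.
  by rewrite (@des_cat a a.+1) ?des1 //; rewrite /a; lia.
rewrite big_ord_recr /= -/a bm step; rewrite bm in E.
rewrite (@letter_ltnNge a); first
  by rewrite [X in (_ + X)%N]addnC addnACA E; case: (_ < _)%N; rewrite ?addn0 ?addn1.
- by rewrite /a; lia.
- by rewrite /a; lia.
- by rewrite neq_ltn ltnSn.
Qed.

End Descents.

(** * Order types of one class *)

Section UClasses.
Variables (n : nat) (r : 'I_n.+1 -> nat) (hr : forall i, (1 <= r i)%N).
Local Notation d := (ring_dim r).
Local Notation wid := (widen_ord (leqnSn n)).
Implicit Types (w : 'S_(ring_dim r)) (c : 'I_n -> int).

Definition tail_sum m := (\sum_(q < n.+1 | (m <= q)%N) r q)%N.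

Lemma tail_sumS (i : 'I_n.+1) : tail_sum i = (r i + tail_sum i.+1)%N.
Proof.
rewrite /tail_sum (bigD1 i) //=; congr addn; apply: eq_bigl => q.
by rewrite andbC -val_eqE /= [RHS]ltn_neqAle eq_sym.
Qed.

Lemma tail_sum_last : tail_sum n.+1 = 0%N.
Proof. by rewrite /tail_sum big1 // => q; rewrite leqNgt ltn_ord. Qed.

Lemma tail_sum0 : (tail_sum 0).+1 = d.
Proof. by []. Qed.

Lemma leq_tail_sum m m' : (m <= m')%N -> (tail_sum m' <= tail_sum m)%N.
Proof.
move=> mm; rewrite /tail_sum [leqRHS](bigID (fun q : 'I_n.+1 => (m' <= q)%N)) /=.
rewrite [X in (_ <= X + _)%N](eq_bigl (fun q : 'I_n.+1 => (m' <= q)%N)) ?leq_addr // => q.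
by rewrite andb_idl // => /(leq_trans mm).
Qed.

Lemma tail_sum_gt0 (i : 'I_n.+1) : (0 < tail_sum i)%N.
Proof. by rewrite tail_sumS addn_gt0 hr. Qed.

Lemma tail_sum_lt m : (tail_sum m < d)%N.
Proof. by rewrite -tail_sum0 ltnS leq_tail_sum. Qed.

(** The letters of [w] are the rows [t, ..., 1], each read backwards, followed by
    the common entry [x_0]: then the words [x_0 x_{i,1} ... x_{i,r_i}] are, up to
    reversal, the blocks of [w] completed by its last letter. *)
Definition position_val (v : Defs.coord r) : nat :=
  if v is Some u then (tail_sum (tag u).+1 + (r (tag u) - (tagged u).+1))%N
  else tail_sum 0.

Lemma position_val_lt v : (position_val v < d)%N.
Proof.
case: v => [[i j]|] /=; last by rewrite tail_sum_lt.
apply: leq_ltn_trans (tail_sum_lt i); rewrite tail_sumS addnC leq_add2r.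
exact: leq_subr.
Qed.

Definition position v : 'I_d := Ordinal (position_val_lt v).

Lemma position_bij : bijective position.
Proof.
have blocks (i i' : 'I_n.+1) j j' : (j < r i)%N -> (j' < r i')%N ->
    (tail_sum i.+1 + (r i - j.+1) = tail_sum i'.+1 + (r i' - j'.+1))%N -> (i <= i')%N.
  move=> ji ji' E; rewrite leqNgt; apply/negP => i'i.
  by have := leq_tail_sum i'i; rewrite (tail_sumS i); lia.
apply: inj_card_bij; last first.
  rewrite card_ord card_option card_tagged sumnE big_map big_enum /=.
  by rewrite ltnS leq_eqVlt; apply/orP; left; apply/eqP/esym/eq_bigr => i _; rewrite card_ord.
move=> u v /(congr1 val) /=; case: u => [[i j]|]; case: v => [[i' j']|] //=.
- move=> E; have ii : i = i'.
    apply/val_inj/eqP; rewrite eqn_leq.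
    by rewrite (blocks _ _ _ _ _ _ E) ?ltn_ord // (blocks _ _ _ _ _ _ (esym E)) ?ltn_ord.
  rewrite -{i'}ii in j' E *; congr (Some (Tagged _ _)); apply: val_inj => /=.
  by have := ltn_ord j; have := ltn_ord j'; lia.
- by have := leq_tail_sum (leq0n i); rewrite tail_sumS; have := ltn_ord j; lia.
- by have := leq_tail_sum (leq0n i'); rewrite tail_sumS; have := ltn_ord j'; lia.
Qed.

Lemma letter_position w i j : (j <= r i)%N ->
  w (position (chain_var r i j)) = letter w (if j == 0 then d else (tail_sum i).+1 - j)%N :> nat.
Proof.
move=> jr; rewrite /letter; congr (val (w _)); apply: val_inj => /=.
rewrite inordK.
  case: j jr => [|j] //= jr; rewrite insubT /= tail_sumS; lia.
case: j jr => [|j] //= jr; rewrite subSS.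
apply: leq_ltn_trans (tail_sum_lt i).
by rewrite (leq_trans (leq_pred _)) ?leq_subr.
Qed.

Definition last_asc w i : bool := (letter w (tail_sum i) < letter w d)%N.

Lemma row_des_position w (i : 'I_n.+1) :
  (row_des (fun v => w (position v)) i + des w (tail_sum i.+1).+1 (tail_sum i) + 1 =
   r i + last_asc w i)%N.
Proof.
have [m rm] : exists m, r i = m.+1 by case: (r i) (hr i) => // m _; exists m.
have tm : tail_sum i = (m.+1 + tail_sum i.+1)%N by rewrite tail_sumS rm.
rewrite /row_des.
rewrite (eq_bigr (fun j : 'I_(r i) =>
  nat_of_bool (letter w (tail_sum i - j) <
    letter w (if j == 0 :> nat then d else (tail_sum i).+1 - j))%N)); last first.
  by move=> j _; rewrite !letter_position ?ltn_ord // ltnW.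
rewrite rm (big_ord_recl m) /= subn0 -/(last_asc w i).
have := @rev_asc_des _ w (tail_sum i) m.
have -> : (tail_sum i - m = (tail_sum i.+1).+1)%N by lia.
have tlt := tail_sum_lt i.
have -> : (m < tail_sum i <= d)%N by rewrite tm leq_addr -tm ltnW.
move=> /(_ isT).
rewrite (eq_bigr (fun j : 'I_m => nat_of_bool
  (letter w (tail_sum i - bump 0 j) < letter w ((tail_sum i).+1 - bump 0 j))%N)).
  by move=> E; rewrite -[(_ + _ + des _ _ _)%N]addnA E addn1 addSn [(m + _)%N]addnC.
by move=> j _; rewrite /bump /= add1n subSS.
Qed.

(** The number of descents of the factor [w_b ... w_d] closed up into a cycle,
    minus one, where [b = tail_sum i]: the closing step from [w_d] to [w_b] is a
    descent exactly if [last_asc w i]. *)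
Definition cyc_des w i : int := (des w (tail_sum i) d)%:Z + (last_asc w i)%:Z - 1.

Lemma tail_sum_range (i : 'I_n.+1) : (0 < tail_sum i <= d)%N.
Proof. by rewrite tail_sum_gt0 ltnW // tail_sum_lt. Qed.

Lemma d_range : (0 < d <= d)%N.
Proof. by rewrite leqnn. Qed.

Lemma cyc_des0 w : cyc_des w 0 = 0.
Proof.
rewrite /cyc_des /last_asc -{1 2}tail_sum0 des1 letter_ltnNge ?leqnn //.
- by rewrite tail_sum0; case: ltnP.
- exact: (tail_sum_range ord0).
- by rewrite neq_ltn ltnSn orbT.
Qed.

(** A step of the cyclic descent numbers is bounded by the number of letters
    between the two starting points; the extreme values force all or none of the
    steps between them to be descents. *)
Lemma cyc_des_step w (k : 'I_n) :
  0 <= cyc_des w k.+1 - cyc_des w k <= (r (wid k))%:Z.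
Proof.
have tk := tail_sumS (wid k); rewrite /= in tk.
have le : (tail_sum k.+1 <= tail_sum k)%N by apply: leq_tail_sum.
have lt := tail_sum_lt k.
rewrite /cyc_des (@des_cat _ w (tail_sum k.+1) (tail_sum k)) ?le 1?ltnW //.
have := des_ge w le; have := des_le w le; rewrite /last_asc.
have -> : (tail_sum k - tail_sum k.+1 = r (wid k))%N by rewrite tk addnK.
case: (ltnP (letter w (tail_sum k.+1))); case: (ltnP (letter w (tail_sum k)));
  case: (ltngtP (letter w (tail_sum k.+1)) (letter w (tail_sum k))) => //=; lia.
Qed.

Section Alpha.
Variable alpha : 'I_n -> nat.

Definition head_sum m := (\sum_(l < n | (l < m)%N) alpha l)%N.

Lemma head_sum0 : head_sum 0 = 0%N.
Proof. by rewrite /head_sum big1. Qed.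

Lemma head_sumS (k : 'I_n) : head_sum k.+1 = (head_sum k + alpha k)%N.
Proof.
rewrite /head_sum (bigD1 k) //= addnC; congr addn; apply: eq_bigl => l.
by rewrite andbC -val_eqE /= [RHS]ltn_neqAle -ltnS.
Qed.

Lemma head_sum_split (k : 'I_n) :
  (head_sum n = head_sum k + \sum_(l < n | (k <= l)%N) alpha l)%N.
Proof.
rewrite /head_sum (bigID (fun l : 'I_n => (l < k)%N)) /=; congr addn.
  by apply: eq_bigl => l; rewrite ltn_ord.
by apply: eq_bigl => l; rewrite ltn_ord -leqNgt.
Qed.

(** The second condition in [inU] says that the partial sums of [alpha] are the
    cyclic descent numbers of the final factors of [w].  In the first one the sum
    over [alpha] may then be replaced by a difference of these numbers; splitting
    [des w] at the blocks turns it into the condition on the descents of the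
    rows. *)
Lemma inUE c w : inU c alpha w =
  in_class c (fun v => w (position v)) &&
  [forall i : 'I_n.+1, cyc_des w i == (head_sum i)%:Z].
Proof.
have iiE (i : 'I_n.+1) : (0 < i)%N ==>
      (let b := (\sum_(q < n.+1 | (i <= q)%N) r q)%N in
      let D := des w b d in
      let S := (\sum_(l < n | (l < i)%N) alpha l)%N in
      [&& (D == S) || (D == S.+1),
          (D == S) ==> (letter w b < letter w d)%N &
          (D == S.+1) ==> (letter w b > letter w d)%N]) =
    (cyc_des w i == (head_sum i)%:Z).
  case: (posnP i) => [i0|i0] /=.
    by rewrite i0 cyc_des0 head_sum0.
  rewrite -/(tail_sum i) -/(head_sum i) /cyc_des /last_asc.
  have := letter_ltnNge w (tail_sum_range i) d_range (negbT (ltn_eqF (tail_sum_lt i))).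
  move=> ->; case: (ltnP (letter w d)) => _ /=.
    rewrite implybF implybT andbT; apply/idP/eqP; last by lia.
    by case: eqP => //= _ /andP[/eqP -> _]; lia.
  rewrite implybT /= implybF; apply/idP/eqP; last by lia.
  by case: eqP => [-> _|] //=; [lia|case: eqP].
rewrite /inU (eq_forallb (P2 := fun i : 'I_n.+1 => cyc_des w i == (head_sum i)%:Z)) //.
have [/forallP S|_] := boolP [forall i : 'I_n.+1, cyc_des w i == (head_sum i)%:Z];
  rewrite ?andbF // !andbT.
rewrite /in_class; apply: eq_forallb => k.
have := eqP (S (wid k)); have := eqP (S ord_max).
have := row_des_position w (wid k); have := row_des_position w ord_max.
move: (row_des _ (wid k)) (row_des _ ord_max) => xk xn.
rewrite /cyc_des /= tail_sum_last -/(tail_sum k.+1) => En Ek Sn Sk.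
have E1 (i : 'I_n.+1) : des w 1 d = (des w 1 (tail_sum i) + des w (tail_sum i) d)%N.
  by rewrite -des_cat //; apply: tail_sum_range.
have E2 : des w 1 (tail_sum k) =
    (des w 1 (tail_sum k.+1).+1 + des w (tail_sum k.+1).+1 (tail_sum k))%N.
  by rewrite -des_cat // (tail_sumS (wid k)) /=; have := hr (wid k); lia.
have := E1 (wid k); have := E1 ord_max => /= E3 E4.
have := head_sum_split k; move: (\sum_(l < n | _) _)%N => rest hs.
clear S iiE E1; move: En Ek Sn Sk E2 E3 E4 hs.
move: (des w 1 d) (des w 1 (tail_sum n)) (des w 1 (tail_sum k))
  (des w (tail_sum n) d) (des w (tail_sum k) d) (des w 1 (tail_sum k.+1).+1)
  (des w (tail_sum k.+1).+1 (tail_sum k)) (nat_of_bool (last_asc w n))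
  (nat_of_bool (last_asc w k)) (head_sum n) (head_sum k) (r ord_max) (r (wid k)) (c k).
by move=> *; apply/eqP/eqP; lia.
Qed.

End Alpha.

Lemma cyc_des_head_sum w (alpha : 'I_n -> nat) :
  [forall i : 'I_n.+1, cyc_des w i == (head_sum alpha i)%:Z] <->
  forall k : 'I_n, (alpha k)%:Z = cyc_des w k.+1 - cyc_des w k.
Proof.
split=> [/forallP S k|H].
  have Sk := eqP (S (wid k)); have Sk1 := eqP (S (Ordinal (ltn_ord k : k.+1 < n.+1)%N)).
  by rewrite /= in Sk Sk1; rewrite Sk Sk1 head_sumS PoszD addrC addKr.
suff S m : (m <= n)%N -> cyc_des w m = (head_sum alpha m)%:Z.
  by apply/forallP => i; rewrite S // leq_ord.
elim: m => [_|m IHm mn]; first by rewrite cyc_des0 head_sum0.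
rewrite (head_sumS alpha (Ordinal mn)) PoszD H /= -IHm ?(ltnW mn) //.
by rewrite addrC subrK.
Qed.

(** The sets [U(alpha)] are disjoint, and every order type in the class lies in
    one of them: [alpha] consists of the successive differences of the cyclic
    descent numbers. *)
Lemma sum_card_U c :
  (\sum_(alpha : {dffun forall i : 'I_n, 'I_(r (wid i)).+1}) #|U r c (fun i => alpha i)| =
   #|[set w : 'S_(ring_dim r) | in_class c (fun v => w (position v))]%SET|)%N.
Proof.
transitivity (\sum_(alpha : {dffun forall i : 'I_n, 'I_(r (wid i)).+1})
    \sum_(w : 'S_(ring_dim r)) inU c (fun i => alpha i) w)%N.
  apply: eq_bigr => alpha _; rewrite -sum1_card big_mkcond /=; apply: eq_bigr => w _.
  by rewrite inE; case: inU.
rewrite exchange_big -sum1_card [RHS]big_mkcond; apply: eq_bigr => w _.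
rewrite inE; case: ifP => [wc|wNc]; last first.
  by rewrite big1 // => alpha _; rewrite inUE wNc.
pose step (k : 'I_n) := `|cyc_des w k.+1 - cyc_des w k|%N.
have stepE k : (step k)%:Z = cyc_des w k.+1 - cyc_des w k.
  by rewrite /step gez0_abs //; have /andP[] := cyc_des_step w k.
have step_lt k : (step k < (r (wid k)).+1)%N.
  by rewrite ltnS -lez_nat stepE; have /andP[] := cyc_des_step w k.
pose alpha0 : {dffun forall i : 'I_n, 'I_(r (wid i)).+1} :=
  [ffun i => Ordinal (step_lt i)].
rewrite (bigD1 alpha0) //= big1 => [|alpha]; last first.
  move=> aa; apply/eqP; rewrite eqb0; apply: contraNN aa.
  rewrite inUE => /andP[_ /cyc_des_head_sum H].
  apply/eqP/ffunP => k; apply: val_inj; rewrite ffunE /=.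
  by apply/eqP; rewrite -eqz_nat H stepE.
rewrite inUE wc addn0 /=; suff -> : [forall i : 'I_n.+1,
  cyc_des w i == (head_sum (fun k => alpha0 k) i)%:Z] by [].
by apply/cyc_des_head_sum => k; rewrite ffunE stepE.
Qed.

End UClasses.

(** * The generalized F-signature *)

Lemma in_class_order_invariant (n : nat) (r : 'I_n.+1 -> nat) (c : 'I_n -> int) :
  order_invariant (@in_class n r c).
Proof.
move=> y z yz; apply: eq_forallb => i.
have E k : row_des y k = row_des z k by apply: eq_bigr => j _; rewrite yz.
by rewrite !E.
Qed.

Theorem theorem5p3 (R : realType) (p : nat) (K : closedFieldType)
    (hp : p \in [pchar K]) (n : nat) (hn : (1 <= n)%N)
    (r : 'I_n.+1 -> nat) (hr : forall i, (1 <= r i)%N)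
    (c : 'I_n -> int)
    (hc : forall i : 'I_n,
        - (r ord_max)%:Z <= c i <= (r (widen_ord (leqnSn n) i))%:Z)
    (hcc : forall i j : 'I_n, (i < j)%N ->
        - (r (widen_ord (leqnSn n) j))%:Z <= c i - c j
          <= (r (widen_ord (leqnSn n) i))%:Z) :
  is_gen_Fsignature p (class_module r K c)
    ((\sum_(alpha : {dffun forall i : 'I_n,
                       'I_(r (widen_ord (leqnSn n) i)).+1})
        #|U r c (fun i => alpha i)|)%N%:R / (ring_dim r)`!%:R : R).
Proof.
rewrite /is_gen_Fsignature sum_card_U //.
under eq_fun do rewrite (multiplicity_class_module hr hp).
apply: (cvg_order_type (position_bij r)); last exact: in_class_order_invariant.
exact: prime_gt1 (pcharf_prime hp).
Qed.
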